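(* Let $D$ be a division ring whose center $k$ has characteristic different from $2$, and let $\ast$ be a $k$-involution on $D$. Let $N$ be a normal subgroup of the multiplicative group $D^{\bullet}=D\setminus\{0\}$, and assume that $N$ contains a torsion-free nilpotent-by-finite subgroup $G$ which is not abelian-by-finite. If $G^\ast=G$ and $N^\ast=N$, then $N$ contains a free symmetric pair with respect to $\ast$, i.e. there exist $u,v\in N$ with $u^\ast=u$, $v^\ast=v$ such that $u,v$ generate a free subgroup of rank $2$ of $D^\bullet$.
   Context: A $k$-involution on a $k$-algebra $R$ is a $k$-linear map $\ast$ with $(xy)^\ast=y^\ast x^\ast$ and $(x^\ast)^\ast=x$ for all $x,y\in R$. A group is nilpotent-by-finite (resp. abelian-by-finite) if it has a nilpotent (resp. abelian) subgroup of finite index. *)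

(* Defs.v *)
From HB Require Import structures.
From mathcomp Require Import all_boot all_order all_algebra.
Set Implicit Arguments. Unset Strict Implicit. Unset Printing Implicit Defensive.
Import GRing.Theory.
Local Open Scope ring_scope.

Section Defs.
Variable R : unitRingType.

Definition division_ring := forall x : R, x != 0 -> x \is a GRing.unit.

Definition central (c : R) := forall y : R, c * y = y * c.

Definition k_involution (s : R -> R) :=
  [/\ (forall x y, s (x + y) = s x + s y),
      (forall c x, central c -> s (c * x) = c * s x),
      (forall x y, s (x * y) = s y * s x) &
      (forall x, s (s x) = x)].

Definition is_subgroup (S : R -> Prop) :=
  [/\ S 1, (forall x, S x -> x != 0),
      (forall x y, S x -> S y -> S (x * y)) &
      (forall x, S x -> S x^-1)].

Definition normal_in_units (S : R -> Prop) :=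
  is_subgroup S /\ forall x y, S x -> y != 0 -> S (y^-1 * x * y).

Definition subset_of (H G : R -> Prop) := forall x, H x -> G x.

Inductive gen (A : R -> Prop) : R -> Prop :=
| gen1 : gen A 1
| genA x : A x -> gen A x
| genM x y : gen A x -> gen A y -> gen A (x * y)
| genV x : gen A x -> gen A x^-1.

Definition comm (x y : R) := x^-1 * y^-1 * x * y.

Fixpoint lcs (H : R -> Prop) (n : nat) : R -> Prop :=
  match n with
  | 0%N => H
  | n'.+1 => gen (fun z => exists x y, lcs H n' x /\ H y /\ z = comm x y)
  end.

Definition nilpotent (H : R -> Prop) := exists n, forall x, lcs H n x -> x = 1.

Definition abelian (H : R -> Prop) := forall x y, H x -> H y -> x * y = y * x.

Definition finite_index (H G : R -> Prop) :=
  exists s : seq R, forall g, G g -> exists2 t, t \in s & exists h, H h /\ g = h * t.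

Definition nilpotent_by_finite (G : R -> Prop) :=
  exists H, [/\ is_subgroup H, subset_of H G, finite_index H G & nilpotent H].

Definition abelian_by_finite (G : R -> Prop) :=
  exists H, [/\ is_subgroup H, subset_of H G, finite_index H G & abelian H].

Definition torsion_free (G : R -> Prop) :=
  forall x n, G x -> (0 < n)%N -> x ^+ n = 1 -> x = 1.

Definition star_stable (s : R -> R) (S : R -> Prop) :=
  forall y, (exists x, S x /\ y = s x) <-> S y.

Definition letter (u v : R) (p : bool * bool) :=
  let g := if p.1 then v else u in if p.2 then g^-1 else g.

Definition eval_word (u v : R) (w : seq (bool * bool)) :=
  foldr (fun p acc => letter u v p * acc) 1 w.

Definition no_cancel (a b : bool * bool) := ~~ ((a.1 == b.1) && (a.2 != b.2)).

Definition reduced_word (w : seq (bool * bool)) := sorted no_cancel w.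

Definition free_pair (u v : R) :=
  forall w, w != [::] -> reduced_word w -> eval_word u v w != 1.

End Defs.

(* Main.v *)
Require Import Defs.
From HB Require Import structures.
From mathcomp Require Import all_boot all_order all_algebra all_field ring.
From Stdlib Require Import Classical.
Import GRing.Theory.
Local Open Scope ring_scope.
Set Implicit Arguments. Unset Strict Implicit. Unset Printing Implicit Defensive.

(** A star-stable nilpotent subgroup of finite index in [G], being torsion-free
and nonabelian, contains [x, y] with [y x = q x y], where [q] is central in
[<x, y>] and of infinite order, and with [star x = x^(+-1)],
[star y = y^(+-1)]: take [x] in the last but one step of the lower central
series and symmetrize [x] and [y] there.

The monomials [x^i y^j] are independent over the scalars, so the subring
generated by [x, y, q] is a quantum plane. It maps to matrices over [F[t]], [x]
to a clock matrix [t diag(z^i)] and [y] to a shift matrix, whenever [q] can be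
specialized to a root of unity [z] of a field [F] (reduce modulo a large prime
when [q] is algebraic over the rationals). The factors [1 + c x] and [1 + c y]
satisfy an explicit Ore condition and become regular matrices, so a relation
between products of such factors and their inverses in [D] gives a relation
between matrices, where inverses are replaced by cofactors.

The commutator [n] of [y] and [1 + c x] lies in [N], so [u = n (star n)] is a
symmetric element of [N]; it is a rational function of [x], as long as [c] is a
scalar. For a suitable [c], at a suitable value of [t], the matrices of [u] and
[u^-1] (with denominators cleared) degenerate to distinct diagonal matrix units.
If [z] has even order, pass to a power of [x] to get [z = -1], and take for [v]
the same function of [y]. If [z] has odd order, take [v = g^-1 u g] with [g] a
rational function of [y] such that [star g = g^-1]. In both cases every letter
degenerates to a rank one matrix, the product of the letters of a reduced word
is nonzero, while the scalar to which it would be equal if the word were trivial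
vanishes. *)

(** * Ore condition in quantum planes *)

Section QuantumPlane.
Variable E : nzRingType.
Implicit Types x y q e c s t r : E.

(** The ambient ring [E] will be [D * B] with [B] a matrix ring: an element carries its matrix image
    along, so that no homomorphism has to be defined on a subring of [D]. *)
Inductive qring (x y q q' : E) : E -> Prop :=
| qring1 : qring x y q q' 1
| qring_q : qring x y q q' q
| qring_q' : qring x y q q' q'
| qring_x : qring x y q q' x
| qring_y : qring x y q q' y
| qringN r of qring x y q q' r : qring x y q q' (- r)
| qringD r s of qring x y q q' r & qring x y q q' s : qring x y q q' (r + s)
| qringM r s of qring x y q q' r & qring x y q q' s : qring x y q q' (r * s).

Lemma qringC x y q q' r : qring x y q q' r -> qring y x q' q r.
Proof.
elim=> *; [exact: qring1|exact: qring_q'|exact: qring_q|exact: qring_y|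
  exact: qring_x|exact: qringN|exact: qringD|exact: qringM].
Qed.

Lemma qringX x y q q' r n : qring x y q q' r -> qring x y q q' (r ^+ n).
Proof.
move=> rr; elim: n => [|n IH]; first exact: qring1.
by rewrite exprS; apply: qringM.
Qed.

(** The denominators of the Ore condition. All powers of [q] have to be allowed, because moving [y]
    across a factor raises the exponent [j] by one. *)
Inductive linprod (e c q x : E) : E -> Prop :=
| linprod1 : linprod e c q x 1
| linprodM j s of linprod e c q x s :
    linprod e c q x ((e + c * q ^+ j * x) * s).

Definition qrel x y q q' :=
  [/\ y * x = q * x * y, q * q' = 1, q' * q = 1,
      GRing.comm q x & GRing.comm q y].

(** Lets everything proved about linear factors in [x] be reused for factors in [y]. *)
Lemma qrelC x y q q' : qrel x y q q' -> qrel y x q' q.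
Proof.
case=> yx qq' q'q qx qy.
have q'x : GRing.comm q' x.
  by rewrite /GRing.comm -[LHS]mulr1 -qq' -!mulrA [x * (q * _)]mulrA -qx !mulrA q'q mul1r.
have q'y : GRing.comm q' y.
  by rewrite /GRing.comm -[LHS]mulr1 -qq' -!mulrA [y * (q * _)]mulrA -qy !mulrA q'q mul1r.
by split=> //; rewrite -[q' * y * x]mulrA yx !mulrA q'q mul1r.
Qed.

Section Ore.
Variables x y q q' e c : E.
Hypothesis rel : qrel x y q q'.
Hypotheses (ex : GRing.comm e x) (ey : GRing.comm e y) (eq : GRing.comm e q).
Hypotheses (cx : GRing.comm c x) (cy : GRing.comm c y) (cq : GRing.comm c q).
Hypotheses (ec : GRing.comm e c).
Hypotheses (qre : qring x y q q' e) (qrc : qring x y q q' c).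

Let lin j := e + c * q ^+ j * x.

Lemma comm_lin a j : GRing.comm a e -> GRing.comm a c -> GRing.comm a q ->
  GRing.comm a x -> GRing.comm a (lin j).
Proof.
move=> ae ac aq ax; apply: commrD => //; apply: commrM => //.
by apply: commrM => //; apply: commrX.
Qed.

Lemma comm_linprod a s : GRing.comm a e -> GRing.comm a c -> GRing.comm a q ->
  GRing.comm a x -> linprod e c q x s -> GRing.comm a s.
Proof.
move=> ae ac aq ax; elim=> [|j {}s _ IH]; first exact: commr1.
by apply: commrM => //; apply: comm_lin.
Qed.

Lemma linprod_comm s1 s2 :
  linprod e c q x s1 -> linprod e c q x s2 -> GRing.comm s1 s2.
Proof.
move=> l1 l2; have [_ _ _ qx _] := rel.
have H a : GRing.comm e a -> GRing.comm c a -> GRing.comm q a ->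
    GRing.comm x a -> GRing.comm s1 a.
  by move=> *; apply: commr_sym; apply: comm_linprod l1; exact: commr_sym.
by apply: comm_linprod (l2); apply: H => //; exact: commr_sym.
Qed.

Lemma linprodMM s1 s2 : linprod e c q x s1 -> linprod e c q x s2 ->
  linprod e c q x (s1 * s2).
Proof.
move=> l1 l2; elim: l1 => [|j s _ IH]; first by rewrite mul1r.
by rewrite -mulrA; constructor.
Qed.

Lemma linprod_qring s : linprod e c q x s -> qring x y q q' s.
Proof.
elim=> [|j {}s _ IH]; first exact: qring1.
apply: qringM => //; apply: qringD => //; apply: qringM; last exact: qring_x.
by apply: qringM => //; apply: qringX; apply: qring_q.
Qed.

Lemma linprod_shift s : linprod e c q x s ->
  exists2 s', linprod e c q x s' & y * s = s' * y.
Proof.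
have [yx qq' q'q qx qy] := rel.
elim=> [|j {}s _ [s' l' E']].
  by exists 1; [exact: linprod1 | rewrite mulr1 mul1r].
exists ((e + c * q ^+ j.+1 * x) * s'); first by constructor.
rewrite -[RHS]mulrA -E' [LHS]mulrA [RHS]mulrA; congr (_ * s).
rewrite mulrDr mulrDl ey; congr (_ + _).
rewrite [y * _]mulrA [y * _]mulrA -cy -[c * y * _]mulrA.
have -> : y * q ^+ j = q ^+ j * y by rewrite (commrX j (commr_sym qy)).
by rewrite -!mulrA yx exprSr !mulrA.
Qed.

(* For [t = y] use [y (e + c q^j x) = (e + c q^j.+1 x) y]; sums are handled by the
   commutativity of the products of linear factors. *)
Lemma linprod_ore t : qring x y q q' t -> forall s, linprod e c q x s ->
  exists s' t', [/\ linprod e c q x s', qring x y q q' t' & s' * t = t' * s].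
Proof.
have [yx qq' q'q qx qy] := rel.
have [_ _ _ q'y q'x] := qrelC rel.
have com a : qring x y q q' a -> GRing.comm a e -> GRing.comm a c -> GRing.comm a q ->
  GRing.comm a x -> forall s, linprod e c q x s ->
  exists s' t', [/\ linprod e c q x s', qring x y q q' t' & s' * a = t' * s].
  move=> qa ae ac aq ax s l; exists s, a; split=> //.
  by rewrite (comm_linprod _ _ _ _ l).
have cq' a : GRing.comm a q -> GRing.comm q' a.
  move=> aq; rewrite /GRing.comm -[LHS]mulr1 -qq' -!mulrA [a * (q * _)]mulrA.
  by rewrite aq !mulrA q'q mul1r.
elim.
- by apply: com; [exact: qring1|exact: commr_sym (commr1 _)..].
- by apply: com => //; [exact: qring_q|exact: commr_sym..].
- by apply: com => //; [exact: qring_q'|exact: cq'..].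
- by apply: com => //; [exact: qring_x|exact: commr_sym..].
- move=> s l; have [s' l' E'] := linprod_shift l.
  by exists s', y; split=> //; exact: qring_y.
- move=> r _ IH s /IH [s' [t' [l' q1 E']]]; exists s', (- t'); split=> //.
    exact: qringN.
  by rewrite mulrN E' mulNr.
- move=> r1 r2 _ IH1 _ IH2 s l.
  have [s1 [t1 [l1 q1 E1]]] := IH1 s l.
  have [s2 [t2 [l2 q2 E2]]] := IH2 s l.
  exists (s1 * s2), (s2 * t1 + s1 * t2); split; first exact: linprodMM.
    by apply: qringD; apply: qringM => //; exact: linprod_qring.
  by rewrite mulrDr {1}(linprod_comm l1 l2) -!mulrA E1 E2 !mulrA -mulrDl.
- move=> r1 r2 _ IH1 _ IH2 s l.
  have [s2 [t2 [l2 q2 E2]]] := IH2 s l.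
  have [s1 [t1 [l1 q1 E1]]] := IH1 s2 l2.
  exists s1, (t1 * t2); split=> //; first exact: qringM.
  by rewrite mulrA E1 -!mulrA E2.
Qed.

End Ore.

End QuantumPlane.

(** * Normal forms and independence *)

Section Scalars.
Variable E : nzRingType.
Implicit Types x y q e c s t r : E.

Lemma comm_int q : commr_rmorph (intr : int -> E) q.
Proof. by move=> n; exact: commr_int. Qed.

Definition evalz q : {rmorphism {poly int} -> E} := horner_morph (comm_int q).

Lemma evalz_comm q a f : GRing.comm a q -> GRing.comm a (evalz q f).
Proof.
move=> aq; rewrite /= /horner_morph horner_coef; apply: commr_sum => i _.
apply: commrM; last exact: commrX.
by rewrite coef_map; apply: commr_int.
Qed.

Lemma evalzX q : evalz q 'X = q.
Proof. by rewrite /= /horner_morph map_polyX hornerX. Qed.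

Lemma evalzC q n : evalz q n%:P = n%:~R.
Proof. by rewrite /= /horner_morph map_polyC hornerC. Qed.

(* Laurent polynomials in [q] with integer coefficients *)
Definition qscalar q r := exists k (f : {poly int}), r * q ^+ k = evalz q f.

Variables (q q' : E).
Hypotheses (qq' : q * q' = 1) (q'q : q' * q = 1).

Lemma qq'X k : q ^+ k * q' ^+ k = 1.
Proof.
by rewrite -exprMn_comm ?qq' ?expr1n // /GRing.comm qq' q'q.
Qed.

Lemma comm_q' a : GRing.comm a q -> GRing.comm a q'.
Proof.
move=> aq; rewrite /GRing.comm -[RHS]mulr1 -qq' -!mulrA [a * (q * _)]mulrA.
by rewrite aq -!mulrA [RHS]mulrA q'q mul1r.
Qed.

Lemma qscalar_comm a r : GRing.comm a q -> qscalar q r -> GRing.comm a r.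
Proof.
move=> aq [k [f Hf]].
have -> : r = evalz q f * q' ^+ k by rewrite -Hf -mulrA qq'X mulr1.
by apply: commrM; [exact: evalz_comm | apply: commrX; exact: comm_q'].
Qed.

Lemma qscalar_evalz f : qscalar q (evalz q f).
Proof. by exists 0, f; rewrite expr0 mulr1. Qed.

Lemma qscalar_int n : qscalar q n%:~R.
Proof. by rewrite -(evalzC q); exact: qscalar_evalz. Qed.

Lemma qscalar_q : qscalar q q.
Proof. by rewrite -{2}(evalzX q); exact: qscalar_evalz. Qed.

Lemma qscalar_q' : qscalar q q'.
Proof. by exists 1%N, 1; rewrite expr1 q'q rmorph1. Qed.

Lemma qscalarD r s : qscalar q r -> qscalar q s -> qscalar q (r + s).
Proof.
move=> [k [f Hf]] [m [g Hg]]; exists (k + m)%N, (f * 'X^m + g * 'X^k).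
rewrite rmorphD !rmorphM !rmorphXn /= evalzX mulrDl {1}exprD mulrA Hf.
by rewrite addnC exprD mulrA Hg.
Qed.

Lemma qscalarN r : qscalar q r -> qscalar q (- r).
Proof.
by move=> [k [f Hf]]; exists k, (- f); rewrite rmorphN -Hf mulNr.
Qed.

Lemma qscalarM r s : qscalar q r -> qscalar q s -> qscalar q (r * s).
Proof.
move=> [k [f Hf]] qs; have [m [g Hg]] := qs; exists (k + m)%N, (f * g).
rewrite rmorphM -Hf -Hg -!mulrA [q ^+ k * (s * _)]mulrA.
by rewrite (qscalar_comm (commr_sym (commrX k (commr_refl q))) qs) -mulrA exprD.
Qed.

Lemma qscalarX r n : qscalar q r -> qscalar q (r ^+ n).
Proof.
move=> h; elim: n => [|n IH]; first exact: (qscalar_int 1).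
by rewrite exprS; apply: qscalarM.
Qed.

Lemma qscalar0 : qscalar q 0. Proof. exact: (qscalar_int 0). Qed.

Variables (x y : E).
Hypothesis rel : qrel x y q q'.

Definition normal_form r := exists N M (c : nat -> nat -> E),
  (forall i j, qscalar q (c i j)) /\
  r = \sum_(i < N) \sum_(j < M) c i j * x ^+ i * y ^+ j.

Lemma normal_form_widen N M N' M' (c : nat -> nat -> E) :
  (N <= N')%N -> (M <= M')%N -> (forall i j, qscalar q (c i j)) ->
  exists c' : nat -> nat -> E, (forall i j, qscalar q (c' i j)) /\
    \sum_(i < N) \sum_(j < M) c i j * x ^+ i * y ^+ j =
    \sum_(i < N') \sum_(j < M') c' i j * x ^+ i * y ^+ j.
Proof.
move=> NN MM qc; exists (fun i j => if (i < N)%N && (j < M)%N then c i j else 0).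
split; first by move=> i j; case: ifP => // _; exact: qscalar0.
rewrite (big_ord_widen N' (fun i => \sum_(j < M) c i j * x ^+ i * y ^+ j) NN).
rewrite big_mkcond; apply: eq_bigr => i _; case: ifP => iN /=.
  rewrite (big_ord_widen M' (fun j => c i j * x ^+ i * y ^+ j) MM).
  rewrite big_mkcond; apply: eq_bigr => j _; case: ifP => //= _.
  by rewrite !mul0r.
by rewrite big1 // => j _; rewrite !mul0r.
Qed.

Lemma normal_formD r s : normal_form r -> normal_form s -> normal_form (r + s).
Proof.
move=> [N1 [M1 [c1 [q1 ->]]]] [N2 [M2 [c2 [q2 ->]]]].
have [d1 [p1 ->]] := normal_form_widen (leq_maxl N1 N2) (leq_maxl M1 M2) q1.
have [d2 [p2 ->]] := normal_form_widen (leq_maxr N1 N2) (leq_maxr M1 M2) q2.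
exists (maxn N1 N2), (maxn M1 M2), (fun i j => d1 i j + d2 i j); split.
  by move=> i j; exact: qscalarD.
rewrite -big_split; apply: eq_bigr => i _.
by rewrite -big_split; apply: eq_bigr => j _; rewrite /= !mulrDl.
Qed.

Lemma normal_formZ a r : qscalar q a -> normal_form r -> normal_form (a * r).
Proof.
move=> qa [N [M [c [qc ->]]]]; exists N, M, (fun i j => a * c i j); split.
  by move=> i j; exact: qscalarM.
rewrite mulr_sumr; apply: eq_bigr => i _.
by rewrite mulr_sumr; apply: eq_bigr => j _; rewrite !mulrA.
Qed.

Lemma normal_formx r : normal_form r -> normal_form (x * r).
Proof.
have [_ _ _ qx qy] := rel.
move=> [N [M [c [qc ->]]]].
exists N.+1, M, (fun i j => if i is i'.+1 then c i' j else 0); split.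
  by move=> [|i] j //; exact: qscalar0.
rewrite [RHS]big_ord_recl [X in _ = X + _]big1 ?add0r => [|j _]; last by rewrite /= !mul0r.
rewrite mulr_sumr; apply: eq_bigr => i _.
rewrite mulr_sumr; apply: eq_bigr => j _ /=.
rewrite !mulrA (qscalar_comm (commr_sym qx) (qc i j)).
by rewrite -[c i j * x * _]mulrA -exprS.
Qed.

Lemma skew_commX i : y * x ^+ i = q ^+ i * x ^+ i * y.
Proof.
have [yx _ _ qx qy] := rel.
elim: i => [|i IH]; first by rewrite !expr0 !mul1r mulr1.
rewrite exprSr mulrA IH -mulrA yx exprSr !mulrA; congr (_ * x * y).
by rewrite -!mulrA; congr (_ * _); apply: commr_sym; exact: commrX.
Qed.

Lemma normal_formy r : normal_form r -> normal_form (y * r).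
Proof.
have [_ _ _ qx qy] := rel.
move=> [N [M [c [qc ->]]]].
exists N, M.+1, (fun i j => if j is j'.+1 then c i j' * q ^+ i else 0); split.
  move=> i [|j]; first exact: qscalar0.
  by apply: qscalarM => //; apply: qscalarX; apply: qscalar_q.
rewrite mulr_sumr; apply: eq_bigr => i _.
rewrite [RHS]big_ord_recl /= !mul0r add0r.
rewrite mulr_sumr; apply: eq_bigr => j _ /=.
rewrite !mulrA (qscalar_comm (commr_sym qy) (qc i j)).
by rewrite -[c i j * y * _]mulrA skew_commX exprS !mulrA.
Qed.

(** Left multiplication by each generator preserves normal forms; the induction therefore proves
    stability under multiplication by [r], which is then applied to 1. *)
Lemma qring_normal_form r : qring x y q q' r -> normal_form r.
Proof.
move=> qr; have nf1 : normal_form 1.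
  exists 1%N, 1%N, (fun _ _ => 1); split; first by move=> _ _; exact: (qscalar_int 1).
  by rewrite !big_ord1 !expr0 !mulr1.
suff H s : normal_form s -> normal_form (r * s) by rewrite -[r]mulr1; exact: H.
elim: qr s => [|||||{}r _ IH|{}r r' _ IH _ IH'|{}r r' _ IH _ IH'] s nfs.
- by rewrite mul1r.
- by apply: normal_formZ => //; exact: qscalar_q.
- by apply: normal_formZ => //; exact: qscalar_q'.
- exact: normal_formx.
- exact: normal_formy.
- rewrite -mulN1r -mulrA; apply: normal_formZ; first exact: (qscalar_int (-1)).
  by auto.
- by rewrite mulrDl; apply: normal_formD; auto.
- by rewrite -mulrA; auto.
Qed.

Lemma qscalar_qring r : qscalar q r -> qring x y q q' r.
Proof.
move=> [k [f Hf]].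
have -> : r = evalz q f * q' ^+ k by rewrite -Hf -mulrA qq'X mulr1.
apply: qringM; last by apply: qringX; exact: qring_q'.
rewrite /= /horner_morph horner_coef.
have qr0 : qring x y q q' 0.
  by rewrite -(subrr 1); apply: qringD; [|apply: qringN]; exact: qring1.
have qrn (n : nat) : qring x y q q' n%:R.
  by elim: n => [|n IH] //; rewrite mulrS; apply: qringD => //; exact: qring1.
elim/big_ind: _ => //; first by move=> *; exact: qringD.
move=> i _; apply: qringM; last by apply: qringX; exact: qring_q.
rewrite coef_map; case: (f`_i) => n; first exact: qrn.
by apply: (@qringN _ x y q q' n.+1%:R); exact: qrn.
Qed.

End Scalars.

Lemma evalz_rmorph (R R' : nzRingType) (h : {rmorphism R -> R'}) a f :
  h (evalz a f) = evalz (h a) f.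
Proof.
rewrite /= /horner_morph -horner_map /= -map_poly_comp.
by congr (_.[_]); apply: eq_map_poly => n /=; exact: rmorph_int.
Qed.

Section Independence.
Variable D : unitRingType.
Hypothesis div : division_ring D.

Lemma div_mul_eq0 (a b : D) : a * b = 0 -> b != 0 -> a = 0.
Proof. by move=> ab /div ub; rewrite -[a](mulrK ub) ab mul0r. Qed.

(* Powers of [w] are eigenvectors of the conjugation by [g], for the distinct
   eigenvalues [l ^+ j]. *)
Lemma eigen_indep (g w l : D) (N : nat) (p : nat -> D) :
  g != 0 -> w != 0 -> g * w = l * w * g -> GRing.comm l w -> l != 0 ->
  (forall m, (0 < m)%N -> l ^+ m != 1) ->
  (forall j, GRing.comm g (p j)) -> (forall j, GRing.comm l (p j)) ->
  GRing.comm l g ->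
  \sum_(j < N) p j * w ^+ j = 0 -> forall j, (j < N)%N -> p j = 0.
Proof.
move=> g0 w0 gw lw l0 lN gp lp lg.
have ug := div g0; have uw := div w0; have ul := div l0.
have gwX j : g * w ^+ j = l ^+ j * w ^+ j * g.
  elim: j => [|j IH]; first by rewrite !expr0 !mul1r mulr1.
  rewrite exprSr mulrA IH -mulrA gw exprSr !mulrA; congr (_ * w * g).
  by rewrite -!mulrA; congr (_ * _); apply: commr_sym; exact: commrX.
elim: N p gp lp => [|N IH] p gp lp; first by move=> _ [].
move=> sum0.
(* Moving [g] past the relation multiplies the [j]-th term by [l ^+ j]. Subtracting [l ^+ N] times
   the original relation removes the last term, and induction applies to the coefficients
   [p i * (l ^+ i - l ^+ N)]. *)
have sum1 : \sum_(j < N.+1) p j * l ^+ j * w ^+ j = 0.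
  apply: (@div_mul_eq0 _ g) => //; rewrite -[RHS](mulr0 g) -[in RHS]sum0 mulr_suml mulr_sumr.
  apply: eq_bigr => j _.
  by rewrite [RHS]mulrA gp -[RHS]mulrA gwX !mulrA.
have H j : (j < N)%N -> p j = 0.
  move=> jN.
  suff /(_ j jN) : forall i, (i < N)%N -> p i * (l ^+ i - l ^+ N) = 0.
    move=> /div_mul_eq0; apply; apply/eqP => /eqP; rewrite subr_eq0 => /eqP E.
    have /lN : (0 < N - j)%N by rewrite subn_gt0.
    case/eqP; apply: (mulrI (unitrX j ul)).
    by rewrite mulr1 -exprD subnKC ?E // ltnW.
  apply: (IH (fun i => p i * (l ^+ i - l ^+ N))) => [i|i|].
  - apply: commrM => //; apply: commrB; apply: commrX; exact: commr_sym.
  - apply: commrM => //; apply: commrB; apply: commrX; exact: commr_refl.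
  - have : \sum_(i < N.+1) p i * l ^+ i * w ^+ i -
           l ^+ N * \sum_(i < N.+1) p i * w ^+ i = 0.
      by rewrite sum0 sum1 mulr0 subr0.
    rewrite mulr_sumr -sumrB big_ord_recr /=.
    rewrite [l ^+ N * _]mulrA -(commrX N (commr_sym (lp N))) subrr addr0 => sum2; rewrite -[RHS]sum2; apply: eq_bigr => i _; rewrite mulrBr mulrBl; congr (_ - _).
    by rewrite [RHS]mulrA -(commrX N (commr_sym (lp i))).
move=> j; rewrite ltnS leq_eqVlt => /orP[/eqP -> | /H //].
move: sum0; rewrite big_ord_recr /= big1 ?add0r => [|i _]; last first.
  by rewrite H ?mul0r.
move=> /div_mul_eq0; apply; apply/negP => /eqP E.
by move: (unitrX N uw); rewrite E unitr0.
Qed.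

End Independence.

(** * Well-definedness of the specialization from [D] to the matrix ring *)

Section Functional.
Variables (D : unitRingType) (B : nzRingType).
Hypothesis div : division_ring D.
Variables (x y q : D) (X Y Q Q' : B).
Hypotheses (x0 : x != 0) (y0 : y != 0) (q0 : q != 0).
Hypothesis qN : forall m, (0 < m)%N -> q ^+ m != 1.
Let xh : D * B := (x, X).
Let yh : D * B := (y, Y).
Let qh : D * B := (q, Q).
Let qh' : D * B := (q^-1, Q').
Hypothesis rel : qrel xh yh qh qh'.
Hypothesis compat : forall f : {poly int}, evalz q f = 0 -> evalz Q f = 0.

Lemma evalz_pair f : evalz qh f = (evalz q f, evalz Q f).
Proof.
rewrite [LHS]surjective_pairing; congr (_, _).
  exact: (evalz_rmorph (@fst D B)).
exact: (evalz_rmorph (@snd D B)).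
Qed.

Lemma qscalar_functional r : qscalar qh r -> r.1 = 0 -> r.2 = 0.
Proof.
have [_ qq' _ _ _] := rel.
move=> [k [f Hf]] r0; have Q'k : Q ^+ k * Q' ^+ k = 1.
  by case: (rel) => _ [_ a] [_ b] _ _; exact: (qq'X a b k).
have Xk n : (qh ^+ n).2 = Q ^+ n by rewrite -[_.2]/(snd (qh ^+ n)) rmorphXn.
have f0 : evalz q f = 0.
  have := congr1 fst Hf; rewrite evalz_pair /= => <-; by rewrite r0 mul0r.
have := congr1 snd Hf; rewrite evalz_pair /= (compat f0) Xk => /(congr1 ( *%R^~ (Q' ^+ k))).
by rewrite -mulrA Q'k mulr1 mul0r.
Qed.

(** The generated subring of [D * B] is the graph of a map: in normal form, independence of the
    monomials in [D] kills the first components of the coefficients, and [compat] then kills the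
    second ones. *)
Lemma qring_functional r : qring xh yh qh qh' r -> r.1 = 0 -> r.2 = 0.
Proof.
have [yx qq' q'q qx qy] := rel.
have xy : x * y = q^-1 * y * x.
  by have [/(congr1 fst) /= E] := qrelC rel; rewrite E.
have qx1 : GRing.comm q x by have := congr1 fst qx.
have qy1 : GRing.comm q y by have := congr1 fst qy.
have yx1 : y * x = q * x * y by have := congr1 fst yx.
move=> /(qring_normal_form qq' q'q rel) [N [M [c [qc ->]]]].
have X1 (z : D * B) n : (z ^+ n).1 = z.1 ^+ n by rewrite -[_.1]/(fst (z ^+ n)) rmorphXn.
have X2 (z : D * B) n : (z ^+ n).2 = z.2 ^+ n by rewrite -[_.2]/(snd (z ^+ n)) rmorphXn.
rewrite -[_.1]/(fst _) -[_.2]/(snd _) !raddf_sum => sum0.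
(* An element of [D] commuting with [q] is completed by [Q] to a pair commuting with [qh], so that
   [qscalar_comm] applies in [D * B]. *)
have cq i j a : GRing.comm a q -> GRing.comm a (c i j).1.
  move=> aq; have /= : GRing.comm (a, Q) (c i j).
    apply: (qscalar_comm qq' q'q _ (qc i j)).
    by change ((a * q, Q * Q) = (q * a, Q * Q)); rewrite aq.
  by move=> /(congr1 fst).
suff c0 i j : (i < N)%N -> (j < M)%N -> (c i j).2 = 0.
  rewrite big1 // => i _; rewrite raddf_sum big1 // => j _ /=.
  by rewrite c0 // !mul0r.
move=> iN jM; apply: qscalar_functional => //.
(* Conjugation by [x] separates the powers of [y], with eigenvalue [q^-1]; then conjugation by [y]
   separates the powers of [x] inside each [p j]. *)
pose p j := \sum_(i < N) (c i j).1 * x ^+ i.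
have qi : q^-1 != 0.
  apply/eqP => q'0; have := congr1 fst qq'; rewrite /= q'0 mulr0 => /eqP.
  by rewrite eq_sym oner_eq0.
have cqi a : GRing.comm a q -> GRing.comm a q^-1 by exact: commrV.
have p0 : p j = 0.
  apply: (@eigen_indep D div x y q^-1 M p) => //.
  - exact: commr_sym (cqi _ (commr_sym qy1)).
  - by move=> m m0; rewrite exprVn; apply: contra (qN m0) => /eqP E; rewrite -[_ ^+ _]invrK E invr1.
  - move=> k; apply: commr_sum => l _; apply: commrM; last exact: commrX.
    by apply: cq; exact: commr_sym.
  - move=> k; apply: commr_sum => l _; apply: commrM.
      by apply: cq; apply: commr_sym; apply: cqi.
    apply: commrX; apply: commr_sym; apply: cqi; exact: commr_sym.
  - by apply: commr_sym; apply: cqi; exact: commr_sym.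
  - rewrite -[RHS]sum0; under eq_bigr do rewrite mulr_suml.
    rewrite exchange_big /=; apply: eq_bigr => k _.
    rewrite -[_.1]/(fst _) raddf_sum; apply: eq_bigr => l _ /=.
    by rewrite !X1.
apply: (@eigen_indep D div y x q N (fun i => (c i j).1)) => //.
- by move=> k; apply: cq; exact: commr_sym.
- by move=> k; apply: cq.
Qed.

End Functional.

(** * Transfer of words from the division ring to a matrix ring *)

Section Transfer.
Variables (D : unitRingType) (A : comNzRingType) (B : algType A).
Hypothesis div : division_ring D.
Variables (x y q : D) (X Y Q Q' : B).
Hypotheses (x0 : x != 0) (y0 : y != 0) (q0 : q != 0).
Hypothesis qN : forall m, (0 < m)%N -> q ^+ m != 1.
Let xh : D * B := (x, X).
Let yh : D * B := (y, Y).
Let qh : D * B := (q, Q).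
Let qh' : D * B := (q^-1, Q').
Hypothesis rel : qrel xh yh qh qh'.
Hypothesis compat : forall f : {poly int}, evalz q f = 0 -> evalz Q f = 0.

Definition lreg (b : B) := forall a, b * a = 0 -> a = 0.

(* [d] and [b / de] are images of the same left fraction over the quantum plane;
   [b] itself carries no denominator, so that [de] may vanish at some point. *)
Definition transfer_frac d b (de : A) := exists s t : D * B,
  [/\ qring xh yh qh qh' s, lreg s.2, qring xh yh qh qh' t,
      s.1 * d = t.1 & s.2 * b = de *: t.2].

(** Phrased as an action by right multiplication on all fractions, which composes along words
    without computing common denominators. *)
Definition transfer d b (de : A) := forall d' b' de',
  transfer_frac d' b' de' -> transfer_frac (d' * d) (b' * b) (de' * de).

Lemma transferM d1 b1 e1 d2 b2 e2 : transfer d1 b1 e1 -> transfer d2 b2 e2 ->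
  transfer (d1 * d2) (b1 * b2) (e1 * e2).
Proof. by move=> t1 t2 d b e l; rewrite !mulrA; apply/t2/t1. Qed.

Lemma transfer_qring r : qring xh yh qh qh' r -> transfer r.1 r.2 1.
Proof.
move=> qr d b e [s [t [qs rs qt E1 E2]]]; exists s, (t * r); split=> //.
- exact: qringM.
- by rewrite mulrA E1.
- by rewrite mulrA E2 mulr1 -scalerAl.
Qed.

Lemma transfer1 : transfer 1 1 1.
Proof. by apply: (transfer_qring (r := 1)); exact: qring1. Qed.

Lemma lregM b1 b2 : lreg b1 -> lreg b2 -> lreg (b1 * b2).
Proof. by move=> r1 r2 a; rewrite -mulrA => /r1 /r2. Qed.

(** Applied to the fraction 1, the hypothesis makes numerator and denominator equal in [D], hence in
    [B] by [qring_functional]; the regular denominator then cancels. *)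
Lemma transfer_final b e : transfer 1 b e -> b = e%:A.
Proof.
have l1 : transfer_frac 1 1 1.
  exists 1, 1; split; try exact: qring1; rewrite ?mulr1 ?scale1r //.
  by move=> a /=; rewrite mul1r.
move=> /(_ _ _ _ l1) [s [t [qs rs qt]]]; rewrite !mulr1 !mul1r => E1 E2.
have H : s.2 - t.2 = 0.
  have qd : qring xh yh qh qh' (s - t) by apply: qringD => //; exact: qringN.
  have := qring_functional div x0 y0 q0 qN rel compat qd.
  by apply; rewrite /= E1 subrr.
apply/eqP; rewrite -subr_eq0; apply/eqP; apply: rs; rewrite mulrBr E2.
by move/eqP: H; rewrite subr_eq0 => /eqP ->; rewrite -scalerAr mulr1 subrr.
Qed.

(** By the Ore condition a left fraction times [l.1^-1] is again a left fraction. In [B] the missing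
    inverse of [l.2] is replaced by the cofactor [Ls], at the cost of the scalar [De]. *)
Lemma transfer_ore l Ls De :
  (forall t, qring xh yh qh qh' t ->
     exists s' t', [/\ qring xh yh qh qh' s', lreg s'.2, qring xh yh qh qh' t' & s' * t = t' * l]) ->
  l.1 != 0 -> l.2 * Ls = De%:A -> transfer l.1^-1 Ls De.
Proof.
move=> ore l0 LL d b e [s [t [qs rs qt E1 E2]]].
have ul := div l0.
have [s' [t' [qs' rs' qt' E]]] := ore t qt.
exists (s' * s), t'; split=> //; first exact: qringM.
- exact: lregM.
- rewrite /= -!mulrA [s.1 * _]mulrA E1 mulrA.
  have := congr1 fst E; rewrite /= => ->.
  by rewrite mulrK.
- rewrite /= -!mulrA [s.2 * _]mulrA E2 -scalerAl -scalerAr mulrA.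
  have := congr1 snd E; rewrite /= => ->.
  by rewrite -mulrA LL -scalerAr mulr1 scalerA.
Qed.

Section Linear.
Variables e c : D * B.
Hypotheses (qe : qscalar qh e) (qc : qscalar qh c).

Let qq' : qh * qh' = 1. Proof. by case: rel. Qed.
Let q'q : qh' * qh = 1. Proof. by case: rel. Qed.

Let scal a r : qscalar qh r -> GRing.comm qh a -> GRing.comm r a.
Proof. by move=> qr qa; apply: commr_sym; apply: (qscalar_comm qq' q'q _ qr); exact: commr_sym. Qed.

Let qq : GRing.comm qh qh. Proof. exact: commr_refl. Qed.
Let qqq' : GRing.comm qh qh'. Proof. by rewrite /GRing.comm qq' q'q. Qed.

Let X2 (r : D * B) n : (r ^+ n).2 = r.2 ^+ n.
Proof. by rewrite -[_.2]/(snd (r ^+ n)) rmorphXn. Qed.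

Lemma lreg_linprod w Q1 s : (forall j, lreg (e.2 + c.2 * Q1.2 ^+ j * w.2)) ->
  linprod e c Q1 w s -> lreg s.2.
Proof.
move=> H; elim=> [|j {}s _ IH]; first by move=> a /=; rewrite mul1r.
by apply: lregM => //=; rewrite X2; exact: H.
Qed.

Lemma transfer_invx Ls De : (forall j, lreg (e.2 + c.2 * Q ^+ j * X)) ->
  (e + c * xh).1 != 0 -> (e + c * xh).2 * Ls = De%:A ->
  transfer (e + c * xh).1^-1 Ls De.
Proof.
have [yx _ _ qx qy] := rel; move=> H; apply: transfer_ore => t qt.
have l1 : linprod e c qh xh (e + c * xh).
  by have := linprodM 0 (linprod1 e c qh xh); rewrite expr0 !mulr1.
have qcq : GRing.comm qh c by apply: commr_sym; exact: scal.
have qre := qscalar_qring qq' q'q xh yh qe.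
have qrc := qscalar_qring qq' q'q xh yh qc.
have [s' [t' [l' qt' E]]] := linprod_ore rel (scal qe qx) (scal qe qy) (scal qe qq)
  (scal qc qx) (scal qc qy) (scal qc qq) (scal qe qcq) qre qrc qt l1.
exists s', t'; split=> //.
  exact: (linprod_qring qre qrc l').
by apply: lreg_linprod l'; exact: H.
Qed.

Lemma transfer_invy Ls De : (forall j, lreg (e.2 + c.2 * Q' ^+ j * Y)) ->
  (e + c * yh).1 != 0 -> (e + c * yh).2 * Ls = De%:A ->
  transfer (e + c * yh).1^-1 Ls De.
Proof.
have [yx _ _ qx qy] := rel; move=> H; apply: transfer_ore => t /qringC qt.
have rel' := qrelC rel.
have l1 : linprod e c qh' yh (e + c * yh).
  by have := linprodM 0 (linprod1 e c qh' yh); rewrite expr0 !mulr1.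
have qcq : GRing.comm qh c by apply: commr_sym; exact: scal.
have qre := qringC (qscalar_qring qq' q'q xh yh qe).
have qrc := qringC (qscalar_qring qq' q'q xh yh qc).
have [s' [t' [l' qt' E]]] := linprod_ore rel' (scal qe qy) (scal qe qx) (scal qe qqq')
  (scal qc qy) (scal qc qx) (scal qc qqq') (scal qe qcq) qre qrc qt l1.
exists s', t'; split=> //.
- by apply: qringC; exact: (linprod_qring qre qrc l').
- by apply: lreg_linprod l'; exact: H.
- exact: qringC.
Qed.

End Linear.

(** The images of [d] and of its inverse are recorded separately: both are cleared of denominators,
    so they are inverse only up to scalars, and both may become singular at a special point. *)
Definition transfer2 d bp (dp : A) bm dm :=
  [/\ d != 0, transfer d bp dp & transfer d^-1 bm dm].

Lemma transfer2M d1 bp1 dp1 bm1 dm1 d2 bp2 dp2 bm2 dm2 :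
  transfer2 d1 bp1 dp1 bm1 dm1 -> transfer2 d2 bp2 dp2 bm2 dm2 ->
  transfer2 (d1 * d2) (bp1 * bp2) (dp1 * dp2) (bm2 * bm1) (dm2 * dm1).
Proof.
move=> [n1 p1 m1] [n2 p2 m2]; split; last 2 first.
- exact: transferM.
- by rewrite invrM ?div //; exact: transferM.
by apply/eqP => E; move/eqP: (div_mul_eq0 div E n2); rewrite (negPf n1).
Qed.

Lemma transfer2V d bp dp bm dm :
  transfer2 d bp dp bm dm -> transfer2 d^-1 bm dm bp dp.
Proof.
move=> [n p m]; split; rewrite ?invrK //.
by apply/negP => /eqP E; have := div n; rewrite -unitrV E unitr0.
Qed.

Lemma transfer2_linx e c Ls De : qscalar qh e -> qscalar qh c ->
  (forall j, lreg (e.2 + c.2 * Q ^+ j * X)) ->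
  e.1 + c.1 * x != 0 -> (e.2 + c.2 * X) * Ls = De%:A ->
  transfer2 (e.1 + c.1 * x) (e.2 + c.2 * X) 1 Ls De.
Proof.
have [yx qq' q'q qx qy] := rel; move=> qe qc H n E; split=> //.
  apply: (transfer_qring (r := e + c * xh)).
  apply: qringD; first exact: qscalar_qring qe.
  by apply: qringM; [exact: qscalar_qring qc|exact: qring_x].
exact: transfer_invx.
Qed.

Lemma transfer2_liny e c Ls De : qscalar qh e -> qscalar qh c ->
  (forall j, lreg (e.2 + c.2 * Q' ^+ j * Y)) ->
  e.1 + c.1 * y != 0 -> (e.2 + c.2 * Y) * Ls = De%:A ->
  transfer2 (e.1 + c.1 * y) (e.2 + c.2 * Y) 1 Ls De.
Proof.
have [yx qq' q'q qx qy] := rel; move=> qe qc H n E; split=> //.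
  apply: (transfer_qring (r := e + c * yh)).
  apply: qringD; first exact: qscalar_qring qe.
  by apply: qringM; [exact: qscalar_qring qc|exact: qring_y].
exact: transfer_invy.
Qed.

Lemma transfer2_qq r r' : qscalar qh r -> qscalar qh r' -> r * r' = 1 -> r' * r = 1 ->
  transfer2 r.1 r.2 1 r'.2 1.
Proof.
have [yx qq' q'q qx qy] := rel; move=> qr qr' E E'.
have E1 := congr1 fst E; have E1' := congr1 fst E'; rewrite /= in E1 E1'.
have n : r.1 != 0.
  by apply/eqP => r0; move: E1; rewrite r0 mul0r => /eqP; rewrite eq_sym oner_eq0.
have -> : transfer2 r.1 r.2 1 r'.2 1 =
          [/\ r.1 != 0, transfer r.1 r.2 1 & transfer r.1^-1 r'.2 1] by [].
split=> //; first by apply: transfer_qring; exact: qscalar_qring qr.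
have -> : r.1^-1 = r'.1 by rewrite -[LHS]mulr1 -E1 mulKr // div.
by apply: transfer_qring; exact: qscalar_qring qr'.
Qed.

Lemma transfer_word u v (M : bool * bool -> B) (de : bool * bool -> A) w :
  (forall p, transfer (letter u v p) (M p) (de p)) ->
  transfer (eval_word u v w) (\prod_(p <- w) M p) (\prod_(p <- w) de p).
Proof.
move=> H; elim: w => [|p w IH]; first by rewrite !big_nil; exact: transfer1.
by rewrite !big_cons /=; exact: transferM.
Qed.

End Transfer.

(** * Rank one products, clock and shift matrices *)

Section RankOne.
Variables (F : fieldType) (n : nat).
Variables (M : bool * bool -> 'M[F]_n.+1).
Variables (col : bool * bool -> 'cV[F]_n.+1) (row : bool * bool -> 'rV[F]_n.+1).
Hypothesis MM : forall p, M p = col p *m row p.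
Hypothesis rc : forall p p', no_cancel p p' -> (row p *m col p') 0 0 != 0.

Lemma no_cancel_refl p : no_cancel p p.
Proof. by rewrite /no_cancel eqxx /= eqxx. Qed.

(** Along a word, the product of the matrices is the first column times the last row, scaled by the
    pairings of the rows with the next columns; in a reduced word none of these pairings
    vanishes. *)
Lemma rank1_prod w : w != [::] -> reduced_word w -> \prod_(p <- w) M p != 0.
Proof.
have row0 p : row p != 0.
  by apply/eqP => r0; move: (rc (no_cancel_refl p)); rewrite r0 mul0mx mxE eqxx.
have col0 p : col p != 0.
  by apply/eqP => r0; move: (rc (no_cancel_refl p)); rewrite r0 mulmx0 mxE eqxx.
case: w => // p w _; rewrite /reduced_word /=.
suff H : path no_cancel p w -> exists2 r : 'rV[F]_n.+1, r != 0 & \prod_(p <- p :: w) M p = col p *m r.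
  move=> /H [r r0 ->]; apply/eqP => E.
  case: (boolP (col p == 0)) (col0 p) => // /eqP.
  have [i ri] : exists i, r 0 i != 0.
    apply/existsP; apply: contraNT r0; rewrite negb_exists => /forallP h.
    by apply/eqP/rowP => i; rewrite mxE; apply/eqP; rewrite -[_ == _]negbK; exact: h.
  case; apply/colP => j; rewrite mxE; move/matrixP/(_ j i): E.
  rewrite !mxE big_ord1 => /eqP; rewrite mulf_eq0 (negPf ri) orbF => /eqP.
  by rewrite /= => ->.
elim: w p => [|p' w IH] p /=.
  by move=> _; exists (row p); rewrite // big_cons big_nil mulr1 MM.
move=> /andP[nc /IH [r r0 E]]; exists ((row p *m col p') 0 0 *: r).
  by rewrite scaler_eq0 negb_or r0 andbT; exact: rc.
rewrite big_cons E MM -[LHS]mulmxA [row p *m _]mulmxA.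
by rewrite [row p *m col p']mx11_scalar mul_scalar_mx [in RHS]mxE eqxx mulr1n.
Qed.

End RankOne.

Section Sharp.
Variables (A : comNzRingType) (B : algType A) (m : nat).
Implicit Types (a b c t : A) (W : B).

(** The second factor when [a%:A + b *: W] is split off from the difference of the [m.+1]-th powers
    of [a%:A] and [- b *: W]; that difference is a scalar as soon as [W ^+ m.+1] is one. *)
Definition cofac a b W : B :=
  \sum_(i < m.+1) a ^+ (m - i) *: (- b *: W) ^+ i.

Lemma cofacP a b W t : W ^+ m.+1 = t%:A ->
  (a%:A + b *: W) * cofac a b W = (a ^+ m.+1 - (- b) ^+ m.+1 * t)%:A.
Proof.
move=> Wm.
have co : GRing.comm (a%:A : B) (- b *: W).
  by rewrite /GRing.comm -scalerAl mul1r -[in RHS]scalerAr mulr1.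
rewrite scalerBl -scalerA -Wm -exprZn.
have -> : a ^+ m.+1 *: (1 : B) = a%:A ^+ m.+1 by rewrite exprZn expr1n.
rewrite subrXX_comm //; congr (_ * _); first by rewrite scaleNr opprK.
by apply: eq_bigr => i _; rewrite [a%:A ^+ _]exprZn expr1n -scalerAl mul1r.
Qed.

Lemma cofacC a b W t : W ^+ m.+1 = t%:A ->
  cofac a b W * (a%:A + b *: W) = (a ^+ m.+1 - (- b) ^+ m.+1 * t)%:A.
Proof.
move=> Wm; rewrite -(cofacP a b Wm).
apply: commr_sym; apply: commr_sum => i _.
have cW : GRing.comm (a%:A + b *: W) W.
  rewrite /GRing.comm mulrDl mulrDr -!scalerAl -!scalerAr.
  by rewrite mul1r mulr1.
rewrite /GRing.comm -scalerAr -scalerAl; congr (_ *: _).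
apply: commrX; rewrite /GRing.comm -scalerAr -scalerAl; congr (_ *: _).
exact: cW.
Qed.

End Sharp.

Section ClockShift.
Variables (m : nat).

Section Ring.
Variable A : comNzRingType.
Implicit Types (a b c t s z : A).

Definition diagf (f : 'I_m.+1 -> A) : 'M[A]_m.+1 := \matrix_(i, j) (f i *+ (i == j)).

Lemma diagfM f g : diagf f * diagf g = diagf (fun i => f i * g i).
Proof.
apply/matrixP => i j; rewrite !mxE (bigD1 i) //= big1 ?addr0 => [|k /negPf ki].
  by rewrite !mxE eqxx mulr1n mulrnAr.
by rewrite !mxE [i == k]eq_sym ki mulr0n mul0r.
Qed.

Lemma eq_diagf f g : f =1 g -> diagf f = diagf g.
Proof. by move=> E; apply/matrixP => i j; rewrite !mxE E. Qed.

Lemma diagfA a : (a%:A : 'M[A]_m.+1) = diagf (fun=> a).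
Proof. by apply/matrixP => i j; rewrite !mxE mulr_natr. Qed.

Lemma diagfZ a f : a *: diagf f = diagf (fun i => a * f i).
Proof. by apply/matrixP => i j; rewrite !mxE mulrnAr. Qed.

Lemma diagfD f g : diagf f + diagf g = diagf (fun i => f i + g i).
Proof. by apply/matrixP => i j; rewrite !mxE mulrnDl. Qed.

Lemma diagfX f n : diagf f ^+ n = diagf (fun i => f i ^+ n).
Proof.
elim: n => [|n IH]; first by rewrite expr0 -[LHS]scale1r diagfA.
by rewrite exprS IH diagfM; apply: eq_diagf => i; rewrite exprS.
Qed.

Lemma diagf_sum n (f : 'I_n -> 'I_m.+1 -> A) :
  \sum_i diagf (f i) = diagf (fun k => \sum_i f i k).
Proof.
apply/matrixP => i j; rewrite summxE !mxE -sumrMnl.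
by apply: eq_bigr => k _; rewrite mxE.
Qed.

Lemma cofac_diagf a b f :
  cofac m a b (diagf f) = diagf (fun i => \sum_(l < m.+1) a ^+ (m - l) * (- b * f i) ^+ l).
Proof.
rewrite /cofac -diagf_sum; apply: eq_bigr => l _.
by rewrite diagfZ diagfX diagfZ.
Qed.

Definition clock t z := diagf (fun i => t * z ^+ i).
Definition shift s : 'M[A]_m.+1 := \matrix_(i, j) (s *+ (j == (i.+1 %% m.+1)%N :> nat)).

Lemma clock_exp t z : z ^+ m.+1 = 1 -> clock t z ^+ m.+1 = (t ^+ m.+1)%:A.
Proof.
move=> zm; rewrite diagfX diagfA; apply: eq_diagf => i.
by rewrite exprMn exprAC zm expr1n mulr1.
Qed.

Lemma shift_exp s n i j :
  (shift s ^+ n) i j = s ^+ n *+ (j == ((i + n) %% m.+1)%N :> nat).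
Proof.
elim: n j => [|n IH] j.
  by rewrite !expr0 addn0 modn_small // mxE eq_sym.
rewrite exprSr mxE; pose k := inord ((i + n) %% m.+1)%N : 'I_m.+1.
have kE : k = ((i + n) %% m.+1)%N :> nat by rewrite inordK // ltn_mod.
rewrite (bigD1 k) //= big1 ?addr0 => [|l /negPf lk].
  rewrite IH mxE kE eqxx mulr1n mulrnAr -exprSr; congr (_ *+ nat_of_bool (_ == _)).
  by rewrite -addn1 modnDml addn1 addnS.
by rewrite IH -kE (inj_eq val_inj) lk mulr0n mul0r.
Qed.

Lemma shift_expn s : shift s ^+ m.+1 = (s ^+ m.+1)%:A.
Proof.
apply/matrixP => i j; rewrite shift_exp !mxE modnDr modn_small // mulr_natr.
by rewrite eq_sym.
Qed.

Lemma shift_clock t s z : z ^+ m.+1 = 1 ->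
  shift s * clock t z = z *: (clock t z * shift s).
Proof.
move=> zm; apply/matrixP => i j; rewrite !mxE.
rewrite (bigD1 j) //= big1 ?addr0 => [|k /negPf kj]; last first.
  by rewrite !mxE kj mulr0n mulr0.
rewrite (bigD1 i) //= big1 ?addr0 => [|k /negPf kj]; last first.
  by rewrite !mxE [i == k]eq_sym kj mulr0n mul0r.
rewrite !mxE !eqxx !mulr1n; case: eqP => [->|_]; last by rewrite mulr0n mul0r mulr0 mulr0.
rewrite mulr1n.
(* Wrap-around in the last row: the exponent of [z] matters only modulo [m.+1]. *)
have zE : z ^+ (i.+1 %% m.+1)%N = z ^+ i.+1.
  by rewrite {2}(divn_eq i.+1 m.+1) exprD mulnC exprM zm expr1n mul1r.
by rewrite zE exprS mulrC [t * _]mulrCA -!mulrA.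
Qed.

End Ring.

Variables (A A' : comNzRingType) (h : {rmorphism A -> A'}).

Lemma map_diagf f : map_mx h (diagf f) = diagf (fun i => h (f i)).
Proof. by apply/matrixP => i j; rewrite !mxE rmorphMn. Qed.

Lemma map_clock t z : map_mx h (clock t z) = clock (h t) (h z).
Proof. by rewrite map_diagf; apply/matrixP => i j; rewrite !mxE rmorphM rmorphXn. Qed.

Lemma map_shift s : map_mx h (shift s) = shift (h s).
Proof. by apply/matrixP => i j; rewrite !mxE rmorphMn. Qed.

Lemma map_cofac a b (W : 'M[A]_m.+1) :
  map_mx h (cofac m a b W) = cofac m (h a) (h b) (map_mx h W).
Proof.
rewrite /cofac raddf_sum; apply: eq_bigr => i _ /=.
by rewrite map_mxZ !rmorphXn /= map_mxZ rmorphN.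
Qed.

Lemma map_mulmx2 (M M' : 'M[A]_m.+1) (P P' : 'M[A']_m.+1) :
  map_mx h M = P -> map_mx h M' = P' -> map_mx h (M * M') = P * P'.
Proof. by move=> <- <-; rewrite rmorphM. Qed.

Lemma map_alg a : map_mx h (a%:A : 'M[A]_m.+1) = (h a)%:A.
Proof. by rewrite map_mxZ rmorph1. Qed.

End ClockShift.

Lemma pairM (R R' : nzRingType) (a c : R) (b d : R') : (a, b) * (c, d) = (a * c, b * d).
Proof. by []. Qed.

(** * The clock and shift model over [F[t]] *)

Section Model.
Variables (D : unitRingType) (x y q : D) (F : fieldType) (z : F) (m : nat) (s : {poly F}).
Hypothesis div : division_ring D.
Hypotheses (x0 : x != 0) (y0 : y != 0) (q0 : q != 0).
Hypothesis qN : forall m, (0 < m)%N -> q ^+ m != 1.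
Hypotheses (yx : y * x = q * x * y) (qx : GRing.comm q x) (qy : GRing.comm q y).
Hypothesis zm : z ^+ m.+1 = 1.
Hypothesis compat : forall f : {poly int}, evalz q f = 0 -> evalz z f = 0.

Local Notation A := {poly F}.
Local Notation B := 'M[{poly F}]_m.+1.
Definition clock_mx : B := clock m 'X z%:P.
Definition shift_mx : B := shift m s.
Definition cst_mx (a : F) : B := (a%:P)%:A.

Lemma cst_mxE a : cst_mx a = (in_alg B \o @polyC F) a. Proof. by []. Qed.

Lemma cst_mxM a b : cst_mx a * cst_mx b = cst_mx (a * b).
Proof. by rewrite !cst_mxE rmorphM. Qed.

Lemma cst_mxX a n : cst_mx a ^+ n = cst_mx (a ^+ n).
Proof. by rewrite !cst_mxE rmorphXn. Qed.

Lemma cst_mx_comm a (b : B) : GRing.comm (cst_mx a) b.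
Proof. by rewrite /GRing.comm -scalerAl -scalerAr mul1r mulr1. Qed.

Lemma cst_mxD a b : cst_mx (a + b) = cst_mx a + cst_mx b.
Proof. by rewrite !cst_mxE rmorphD. Qed.

Lemma cst_mxN a : cst_mx (- a) = - cst_mx a.
Proof. by rewrite !cst_mxE rmorphN. Qed.

Lemma cst_mx0 : cst_mx 0 = 0. Proof. by rewrite cst_mxE rmorph0. Qed.

Lemma cst_mx1 : cst_mx 1 = 1. Proof. by rewrite cst_mxE rmorph1. Qed.

Lemma model_rel : qrel (x, clock_mx) (y, shift_mx) (q, cst_mx z) (q^-1, cst_mx (z ^+ m)).
Proof.
have uq := div q0; split.
- by rewrite !pairM yx shift_clock -?polyC_exp ?zm // -scalerAl mul1r scalerAl.
- by rewrite pairM divrr // cst_mxM -exprS zm cst_mx1.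
- by rewrite pairM mulVr // cst_mxM -exprSr zm cst_mx1.
- by rewrite /GRing.comm !pairM qx cst_mx_comm.
- by rewrite /GRing.comm !pairM qy cst_mx_comm.
Qed.

Lemma model_compat f : evalz q f = 0 -> evalz (cst_mx z) f = 0.
Proof. by move=> /compat E; rewrite cst_mxE -evalz_rmorph E rmorph0. Qed.

(* The scalar [e] of the quantum plane specializes to [e2]. *)
Definition scal_pair (e : D) (e2 : F) := qscalar ((q, cst_mx z) : D * B) (e, cst_mx e2).

Let qq' := let: And5 _ a _ _ _ := model_rel in a.
Let q'q := let: And5 _ _ a _ _ := model_rel in a.

Lemma scal_pairM e e2 c c2 : scal_pair e e2 -> scal_pair c c2 -> scal_pair (e * c) (e2 * c2).
Proof. by move=> a b; have := qscalarM qq' q'q a b; rewrite pairM cst_mxM. Qed.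
Lemma scal_pairD e e2 c c2 : scal_pair e e2 -> scal_pair c c2 -> scal_pair (e + c) (e2 + c2).
Proof.
by move=> a b; have := qscalarD a b; rewrite /scal_pair cst_mxD.
Qed.
Lemma scal_pairN e e2 : scal_pair e e2 -> scal_pair (- e) (- e2).
Proof. by move=> a; have := qscalarN a; rewrite /scal_pair cst_mxN. Qed.
Lemma scal_pairB e e2 c c2 : scal_pair e e2 -> scal_pair c c2 -> scal_pair (e - c) (e2 - c2).
Proof. by move=> a b; exact: scal_pairD a (scal_pairN b). Qed.
Lemma scal_pair1 : scal_pair 1 1.
Proof. by rewrite /scal_pair cst_mx1; exact: (qscalar_int _ 1). Qed.
Lemma scal_pair_nat n : scal_pair n%:R n%:R.
Proof.
elim: n => [|n IH]; first by rewrite /scal_pair cst_mx0; exact: (qscalar_int _ 0).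
by rewrite !mulrS; exact: scal_pairD scal_pair1 IH.
Qed.
Lemma scal_pair_q : scal_pair q z. Proof. exact: qscalar_q. Qed.
Lemma scal_pair_qV : scal_pair q^-1 z^-1.
Proof.
have -> : z^-1 = z ^+ m.
  have z0 : z != 0 by apply/eqP => z0; move: zm; rewrite z0 expr0n => /eqP; rewrite eq_sym oner_eq0.
  by apply: (mulfI z0); rewrite -exprS zm divff.
exact: qscalar_q' q'q.
Qed.

(** A zero scalar of [D] has zero image, so nonvanishing can be checked after specialization. *)
Lemma scal_pair_neq0 e e2 : scal_pair e e2 -> e2 != 0 -> e != 0.
Proof.
move=> h; apply: contra => /eqP e0.
have /= := qscalar_functional model_rel model_compat h e0.
move=> /matrixP /(_ ord0 ord0); rewrite !mxE eqxx mulr1.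
by move=> /eqP; rewrite polyC_eq0.
Qed.

Lemma scal_pair_comm a e e2 : GRing.comm a q -> scal_pair e e2 -> GRing.comm a e.
Proof.
move=> aq h; have c : GRing.comm ((a, 1) : D * B) (q, cst_mx z).
  by rewrite /GRing.comm !pairM aq mul1r mulr1.
by have := qscalar_comm qq' q'q c h => /(congr1 fst).
Qed.

Definition model_transfer := transfer2 x y q clock_mx shift_mx (cst_mx z) (cst_mx (z ^+ m)).

Lemma lreg_cofac (W : B) (L : B) (de : A) : L * W = de%:A -> de != 0 -> lreg W.
Proof.
move=> E de0 a Wa; have : L * (W * a) = 0 by rewrite Wa mulr0.
rewrite mulrA E -scalerAl mul1r => /matrixP h; apply/matrixP => i j.
by move: (h i j); rewrite !mxE => /eqP; rewrite mulf_eq0 (negPf de0) /= => /eqP.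
Qed.

(** A relation [e + c * w = 0] would be a dependence between 1 and [w], forcing [e = 0], against the
    nonzero image [e2]. *)
Lemma lin_neq0 (g w l e c : D) e2 c2 : g != 0 -> w != 0 -> g * w = l * w * g ->
  GRing.comm l w -> l != 0 -> (forall k, (0 < k)%N -> l ^+ k != 1) ->
  GRing.comm g q -> GRing.comm l q -> GRing.comm l g ->
  scal_pair e e2 -> scal_pair c c2 -> e2 != 0 -> e + c * w != 0.
Proof.
move=> g0 w0 gw lw l0 lN gq lq lg he hc e20; apply/eqP => E.
have /eqP e0 := scal_pair_neq0 he e20; apply: e0.
have H : forall j, (j < 2)%N -> (if j is 0%N then e else c) = 0.
  apply: (@eigen_indep D div g w l 2 (fun j => if j is 0%N then e else c)) => //.
  - by case=> [|j]; [exact: scal_pair_comm he|exact: scal_pair_comm hc].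
  - by case=> [|j]; [exact: scal_pair_comm he|exact: scal_pair_comm hc].
  - by rewrite big_ord_recr big_ord1 /= expr0 expr1 mulr1.
exact: (H 0%N).
Qed.

Lemma linx_neq0 e e2 c c2 : scal_pair e e2 -> scal_pair c c2 -> e2 != 0 -> e + c * x != 0.
Proof.
by apply: (lin_neq0 (g := y) (l := q)).
Qed.

Lemma liny_neq0 e e2 c c2 : scal_pair e e2 -> scal_pair c c2 -> e2 != 0 -> e + c * y != 0.
Proof.
have uq := div q0.
have cV a : GRing.comm q a -> GRing.comm q^-1 a.
  by move=> h; apply: commr_sym; apply: commrV; exact: commr_sym.
apply: (lin_neq0 (g := x) (l := q^-1)) => //.
- have [/(congr1 fst) /= //] := qrelC model_rel.
- exact: cV.
- by apply/eqP => E; move: uq; rewrite -unitrV E unitr0.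
- by move=> k k0; rewrite exprVn; apply: contra (qN k0) => /eqP E; rewrite -[_ ^+ _]invrK E invr1.
- by apply: cV; exact: commr_refl.
- exact: cV.
Qed.

(** Since [a ^+ m.+1 = 1], the power [a ^+ j] drops out of the scalar of the cofactor identity; one
    nonzero scalar makes all the factors of the Ore condition regular at once. *)
Lemma cst_shift_cofac (W : B) t e2 c2 a j : W ^+ m.+1 = t%:A -> a ^+ m.+1 = 1 ->
  e2%:P ^+ m.+1 - (- c2%:P) ^+ m.+1 * t != 0 ->
  lreg (cst_mx e2 + cst_mx c2 * cst_mx a ^+ j * W).
Proof.
move=> Wt am de0; apply: (@lreg_cofac _ (cofac m e2%:P (c2 * a ^+ j)%:P W)) de0.
rewrite cst_mxX cst_mxM -scalerAl mul1r (cofacC _ _ Wt).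
by rewrite polyCM -[- (c2%:P * _)]mulNr exprMn -[(a ^+ j)%:P ^+ _]polyC_exp exprAC am expr1n mulr1.
Qed.

Lemma clock_mxX : clock_mx ^+ m.+1 = ('X ^+ m.+1)%:A.
Proof. by rewrite clock_exp // -polyC_exp zm. Qed.

Lemma shift_mxX : shift_mx ^+ m.+1 = (s ^+ m.+1)%:A.
Proof. exact: shift_expn. Qed.

Lemma model_transfer_linx e e2 c c2 : scal_pair e e2 -> scal_pair c c2 -> e2 != 0 ->
  model_transfer (e + c * x) (cst_mx e2 + c2%:P *: clock_mx) 1
    (cofac m e2%:P c2%:P clock_mx) (e2%:P ^+ m.+1 - (- c2%:P) ^+ m.+1 * 'X ^+ m.+1).
Proof.
move=> he hc e20.
(* At [t = 0] only [e2 ^+ m.+1] is left. *)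
have de0 : e2%:P ^+ m.+1 - (- c2%:P) ^+ m.+1 * 'X ^+ m.+1 != 0.
  apply/negP => /eqP /(congr1 (fun p => p.[0])).
  rewrite hornerD hornerN hornerM hornerXn expr0n mulr0 subr0 -polyC_exp hornerC horner0 => /eqP.
  by rewrite expf_eq0 (negPf e20) andbF.
have -> : c2%:P *: clock_mx = cst_mx c2 * clock_mx by rewrite -scalerAl mul1r.
apply: (@transfer2_linx _ _ _ div x y q clock_mx shift_mx (cst_mx z) _ model_rel (e, cst_mx e2) (c, cst_mx c2)) => //=.
- by move=> j; exact: cst_shift_cofac clock_mxX zm de0.
- exact: linx_neq0 hc e20.
- by rewrite -scalerAl mul1r; exact: cofacP clock_mxX.
Qed.

Lemma model_transfer_liny e e2 c c2 : scal_pair e e2 -> scal_pair c c2 -> e2 != 0 ->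
  e2%:P ^+ m.+1 - (- c2%:P) ^+ m.+1 * s ^+ m.+1 != 0 ->
  model_transfer (e + c * y) (cst_mx e2 + c2%:P *: shift_mx) 1
    (cofac m e2%:P c2%:P shift_mx) (e2%:P ^+ m.+1 - (- c2%:P) ^+ m.+1 * s ^+ m.+1).
Proof.
move=> he hc e20 de0.
have -> : c2%:P *: shift_mx = cst_mx c2 * shift_mx by rewrite -scalerAl mul1r.
apply: (@transfer2_liny _ _ _ div x y q clock_mx shift_mx (cst_mx z) _ model_rel (e, cst_mx e2) (c, cst_mx c2)) => //=.
- move=> j; apply: cst_shift_cofac shift_mxX _ de0.
  by rewrite -exprM mulnC exprM zm expr1n.
- exact: liny_neq0 hc e20.
- by rewrite -scalerAl mul1r; exact: cofacP shift_mxX.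
Qed.

Lemma model_transfer_scal e e' e2 e2' : scal_pair e e2 -> scal_pair e' e2' -> e * e' = 1 -> e' * e = 1 ->
  e2 * e2' = 1 -> model_transfer e (cst_mx e2) 1 (cst_mx e2') 1.
Proof.
move=> he he' E E' E2.
apply: (@transfer2_qq _ _ _ div x y q clock_mx shift_mx (cst_mx z) _ model_rel (e, cst_mx e2) (e', cst_mx e2')) => //.
- by rewrite pairM E cst_mxM E2 cst_mx1.
- by rewrite pairM E' cst_mxM mulrC E2 cst_mx1.
Qed.

Definition cofac_scal (e2 c2 : F) (p : {poly F}) : {poly F} := e2%:P ^+ m.+1 - (- c2%:P) ^+ m.+1 * p ^+ m.+1.

(** Inverting the quotient exchanges numerator and denominator. In each scalar the factor 1 comes
    from the linear factor and the other one from the cofactor. *)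
Lemma model_transfer_quotx e e2 c c2 e' e2' c' c2' : scal_pair e e2 -> scal_pair c c2 -> e2 != 0 ->
  scal_pair e' e2' -> scal_pair c' c2' -> e2' != 0 ->
  model_transfer ((e + c * x) * (e' + c' * x)^-1)
    ((cst_mx e2 + c2%:P *: clock_mx) * cofac m e2'%:P c2'%:P clock_mx) (1 * cofac_scal e2' c2' 'X)
    ((cst_mx e2' + c2'%:P *: clock_mx) * cofac m e2%:P c2%:P clock_mx) (1 * cofac_scal e2 c2 'X).
Proof.
move=> *; apply: transfer2M => //; last (apply: transfer2V => //); exact: model_transfer_linx.
Qed.

Lemma model_transfer_quoty e e2 c c2 e' e2' c' c2' : scal_pair e e2 -> scal_pair c c2 -> e2 != 0 ->
  scal_pair e' e2' -> scal_pair c' c2' -> e2' != 0 -> cofac_scal e2 c2 s != 0 -> cofac_scal e2' c2' s != 0 ->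
  model_transfer ((e + c * y) * (e' + c' * y)^-1)
    ((cst_mx e2 + c2%:P *: shift_mx) * cofac m e2'%:P c2'%:P shift_mx) (1 * cofac_scal e2' c2' s)
    ((cst_mx e2' + c2'%:P *: shift_mx) * cofac m e2%:P c2%:P shift_mx) (1 * cofac_scal e2 c2 s).
Proof.
move=> *; apply: transfer2M => //; last (apply: transfer2V => //); exact: model_transfer_liny.
Qed.

Variable t0 : F.
Definition ev : {rmorphism {poly F} -> F} := horner_eval t0.

(** The matrix of a nonempty word equal to 1 would be the scalar matrix of the product of its
    denominators, which vanishes at [t0]; but at [t0] the letters have rank one and [rank1_prod]
    applies. *)
Lemma model_transfer_free u v (Mu Mu' Mv Mv' : B) (du du' dv dv' : A)
    (col : bool * bool -> 'cV[F]_m.+1) (row : bool * bool -> 'rV[F]_m.+1) :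
  model_transfer u Mu du Mu' du' -> model_transfer v Mv dv Mv' dv' ->
  du.[t0] = 0 -> du'.[t0] = 0 -> dv.[t0] = 0 -> dv'.[t0] = 0 ->
  (forall p, map_mx ev (if p.1 then if p.2 then Mv' else Mv else if p.2 then Mu' else Mu)
     = col p *m row p) ->
  (forall p p', no_cancel p p' -> (row p *m col p') 0 0 != 0) ->
  free_pair u v.
Proof.
move=> [_ tu tu'] [_ tv tv'] u0 u0' v0 v0' E rc w w0 rw; apply/eqP => w1.
pose M (p : bool * bool) := if p.1 then if p.2 then Mv' else Mv else if p.2 then Mu' else Mu.
pose de (p : bool * bool) := if p.1 then if p.2 then dv' else dv else if p.2 then du' else du.
have /(transfer_word w) : forall p, transfer x y q clock_mx shift_mx (cst_mx z) (cst_mx (z ^+ m))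
   (letter u v p) (M p) (de p) by case=> [[] []].
rewrite w1 => /(transfer_final div x0 y0 q0 qN model_rel model_compat) H.
have := congr1 (map_mx ev) H; rewrite map_alg !rmorph_prod /=.
case: w w0 rw {w1 H} => // p w _ rw.
rewrite [X in _ = X%:A]big_cons.
have -> : horner_eval t0 (de p) = 0 by rewrite /horner_eval; case: p {rw} => [[] []].
rewrite mul0r scale0r; apply/eqP; apply: (rank1_prod (col := col) (row := row)) => //.
Qed.

Lemma ev_quotx e2 c2 e2' c2' :
  map_mx ev ((cst_mx e2 + c2%:P *: clock_mx) * cofac m e2'%:P c2'%:P clock_mx) =
  diagf (fun i : 'I_m.+1 => (e2 + c2 * (t0 * z ^+ i)) *
     \sum_(l < m.+1) e2' ^+ (m - l) * (- c2' * (t0 * z ^+ i)) ^+ l).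
Proof.
have evC a : ev a%:P = a by rewrite /= /horner_eval hornerC.
rewrite rmorphM rmorphD /= map_alg map_mxZ map_cofac !map_clock -/ev !evC.
have -> : ev 'X = t0 by rewrite /= /horner_eval hornerX.
by rewrite cofac_diagf diagfZ diagfA diagfD diagfM.
Qed.

Lemma ev_quoty e2 c2 e2' c2' :
  map_mx ev ((cst_mx e2 + c2%:P *: shift_mx) * cofac m e2'%:P c2'%:P shift_mx) =
  (e2%:A + c2 *: shift m s.[t0]) * cofac m e2' c2' (shift m s.[t0]).
Proof.
have evC a : ev a%:P = a by rewrite /= /horner_eval hornerC.
by rewrite rmorphM rmorphD /= map_alg map_mxZ map_cofac !map_shift -/ev !evC.
Qed.

Lemma ev_cofac_scal e2 c2 p : (cofac_scal e2 c2 p).[t0] = e2 ^+ m.+1 - (- c2) ^+ m.+1 * p.[t0] ^+ m.+1.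
Proof. by rewrite /cofac_scal -polyCN -!polyC_exp !hornerE. Qed.

End Model.

(** * The case of a specialization of order two *)

Section OrderTwo.
Variables (D : unitRingType) (x y q : D) (F : fieldType).
Hypothesis div : division_ring D.
Hypotheses (x0 : x != 0) (y0 : y != 0) (q0 : q != 0).
Hypothesis qN : forall m, (0 < m)%N -> q ^+ m != 1.
Hypotheses (yx : y * x = q * x * y) (qx : GRing.comm q x) (qy : GRing.comm q y).
Hypothesis compat : forall f : {poly int}, evalz q f = 0 -> evalz (-1 : F) f = 0.
Hypothesis F2 : (2%:R : F) != 0.

Local Notation scal := (@scal_pair D q F (-1) 1).
Local Notation tr := (@model_transfer D x y q F (-1) 1 'X).

Let zm : (-1 : F) ^+ 2 = 1. Proof. by rewrite sqrrN expr1n. Qed.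

(* [n (star n)] for [n] the commutator of [y] and [1 + x] has this form, by [star_mobius]. *)
Definition norm_mobius (q1 k q2 w : D) := ((1 + q1 * w) * (1 + 1 * w)^-1) * (k * ((1 + q2 * w) * (1 + 1 * w)^-1)).

(** At [t = -1] the clock matrix is diagonal with entries -1 and 1, and the shift matrix has
    eigenvectors (1, 1) and (1, -1). The letters of the first element degenerate to projections onto
    coordinate lines, those of the second onto eigenlines of the shift, up to scalars; only opposite
    letters pair to zero. *)
Lemma free_order_two k k' k2 q1 l l' l2 q2 q3 q4 :
  scal k k2 -> scal k' k2^-1 -> k * k' = 1 -> k' * k = 1 -> k2 != 0 -> scal q1 (-1) -> scal q2 (-1) ->
  scal l l2 -> scal l' l2^-1 -> l * l' = 1 -> l' * l = 1 -> l2 != 0 -> scal q3 (-1) -> scal q4 (-1) ->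
  free_pair (norm_mobius q1 k q2 x) (norm_mobius q3 l q4 y).
Proof.
move=> k_k2 k_k2' kk k'k k20 s1 s2 l_l2 l_l2' ll l'l l20 s3 s4.
have one0 : (1 : F) != 0 by exact: oner_neq0.
have s_1 : scal 1 1 by exact: scal_pair1.
have dl a : a ^+ 2 = 1 -> cofac_scal 1 1 a 'X != 0 :> {poly F}.
  move=> a1; apply/negP => /eqP /(congr1 (fun p => p.[0])).
  by rewrite ev_cofac_scal hornerX expr0n mulr0 subr0 horner0 expr1n => /eqP; rewrite (negPf one0).
have dl1 : cofac_scal 1 1 1 'X != 0 :> {poly F} by apply: dl; rewrite expr1n.
have dlN : cofac_scal 1 1 (-1) 'X != 0 :> {poly F} by apply: dl.
have Tx a : scal a (-1) -> _ := fun h => model_transfer_quotx 'X div x0 y0 q0 qN yx qx qy zm compat s_1 h one0 s_1 s_1 one0.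
have Ty a : scal a (-1) -> _ := fun h => model_transfer_quoty div x0 y0 q0 qN yx qx qy zm compat (s := 'X) s_1 h one0 s_1 s_1 one0 dlN dl1.
have Tk := model_transfer_scal 'X div q0 yx qx qy zm k_k2 k_k2' kk k'k (divff k20).
have Tl := model_transfer_scal 'X div q0 yx qx qy zm l_l2 l_l2' ll l'l (divff l20).
have Tu := transfer2M div (Tx _ s1) (transfer2M div Tk (Tx _ s2)).
have Tv := transfer2M div (Ty _ s3) (transfer2M div Tl (Ty _ s4)).
pose c := fun p : bool * bool => (if p.1 then if p.2 then l2^-1 else l2
                                  else if p.2 then k2^-1 else k2).
(* With [X] and [Y] the clock and shift matrices at [t = -1], the squares of [1 - X] and [1 + X] are
   4 times diagonal matrix units, while [M = 1 - Y] and [M = 1 + Y] satisfy [M ^+ 2 = 2 M]. Every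
   letter contains a fourth power, whence 16 as the square of 4 and 8 as the cube of 2. *)
pose col := fun p : bool * bool => \col_(i < 2) (c p *
   (if p.1 then 8%:R * (if p.2 then (-1) ^+ i else 1) else 16%:R * (i == p.2 :> nat)%:R)).
pose row := fun p : bool * bool => \row_(i < 2)
   (if p.1 then (if p.2 then (-1) ^+ i else 1) else (i == p.2 :> nat)%:R : F).
have dlt0 a p : a ^+ 2 = 1 -> p.[(-1 : F)] = -1 -> (cofac_scal 1 1 a p).[-1] = 0 :> F.
  by move=> a1 p1; rewrite ev_cofac_scal p1 sqrrN expr1n a1 zm mulr1 subrr.
have a1 : (1 : F) ^+ 2 = 1 by rewrite expr1n.
have F8 : (8%:R : F) != 0 by rewrite -[8%N]/(2 ^ 3)%N natrX expf_neq0.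
have F16 : (16%:R : F) != 0 by rewrite -[16%N]/(2 ^ 4)%N natrX expf_neq0.
(* The pairing of a letter of the second element with itself, up to the factor [c p]. *)
have F88 : (8%:R + 8%:R : F) != 0 by rewrite -natrD.
have c0 p : c p != 0 by case: p => [[] []]; rewrite /c /= ?invr_eq0.
apply: (model_transfer_free div x0 y0 q0 qN yx qx qy zm compat (t0 := -1) Tu Tv (col := col) (row := row)).
1-4: by rewrite !hornerM !dlt0 ?hornerX // ?mulr0 ?mul0r.
- have ev3 (a b d : 'M[{poly F}]_2) : map_mx (ev (-1)) (a * (b * d)) =
      map_mx (ev (-1)) a * map_mx (ev (-1)) b * map_mx (ev (-1)) d by rewrite !rmorphM mulrA.
  have evk k3 : map_mx (ev (-1)) (cst_mx 1 k3) = (k3%:A : 'M[F]_2).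
    by rewrite map_alg /= /horner_eval hornerC.
  have key k3 (N : 'M[F]_2) : N * (k3%:A : 'M[F]_2) * N = k3 *: (N * N).
    by rewrite -scalerAr mulr1 -scalerAl.
  have cofE a (W : 'M[F]_2) : cofac 1 1 a W = 1%:A - a *: W.
    by rewrite /cofac big_ord_recr big_ord1 /= !expr1n !scale1r expr0 expr1 scaleNr.
  have EY (a : F) : a ^+ 2 = 1 -> 1%:A + a *: shift 1 'X.[-1] = \matrix_(i < 2, j < 2) (- a) ^+ (i + j).
    move=> aa; apply/matrixP => i j; rewrite hornerX !mxE.
    by case: i j => [[|[|//]] ?] [[|[|//]] ?] /=;
      rewrite ?sqrrN ?aa ?mulr1 ?mulr0 ?mulr0n ?mulr1n ?addr0 ?add0r ?expr1 ?mulrN1.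
  have EYY (b : F) : b ^+ 2 = 1 -> let M := \matrix_(i < 2, j < 2) b ^+ (i + j) in
      M * M * (M * M) = \matrix_(i < 2, j < 2) (8%:R * (b ^+ i * b ^+ j)).
    move=> bb M; have MM : M * M = 2%:R *: M.
      apply/matrixP => i j; rewrite !mxE big_ord_recr big_ord1 !mxE /= addn0 !exprD expr0 expr1 mul1r.
      by rewrite -mulrA [b * (b * _)]mulrA -expr2 bb mul1r mulr_natl mulr2n.
    rewrite MM -scalerAl -scalerAr MM !scalerA -!natrM.
    by apply/matrixP => i j; rewrite !mxE exprD.
  have EXX (a : F) (kb : bool) : a = (-1) ^+ kb.+1 ->
     let N := diagf (fun i : 'I_2 => (1 + a * (-1 * (-1) ^+ i)) *
       \sum_(l < 2) 1 ^+ (1 - l) * (a * (-1 * (-1) ^+ i)) ^+ l) in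
     N * N = \matrix_(i < 2, j < 2) (16%:R * ((i == kb :> nat)%:R * (j == kb :> nat)%:R)).
    move=> aE /=; rewrite diagfM; apply/matrixP => i j; rewrite !mxE !big_ord_recr big_ord0 /= add0r !expr1n !mul1r expr0 expr1 aE.
    case: kb {aE} i j => [] [[|[|//]] ?] [[|[|//]] ?] /=;
      rewrite ?expr0 ?expr1 ?zm ?mulr1 ?mul1r ?mulrNN ?mulr1 ?mulr0n ?mulr1n ?subrr ?mul0r ?mulr0 //; ring.
  case=> [[] []]; rewrite [X in map_mx _ X]/= -?[_ * _ * cst_mx _ _ * _]mulrA ev3 evk key ?ev_quotx ?ev_quoty ?cofE -?scaleNr ?opprK.
  + rewrite EY // EYY ?sqrrN //; apply/matrixP => i j; rewrite !mxE big_ord1 !mxE /=.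
    by rewrite /c /= !mulrA.
  + rewrite EY // EYY ?opprK //; apply/matrixP => i j; rewrite !mxE big_ord1 !mxE /=.
    by rewrite !expr1n !mulr1.
  + rewrite (EXX 1 true) ?zm //; apply/matrixP => i j; rewrite !mxE big_ord1 !mxE /=.
    by rewrite /c /= !mulrA.
  + rewrite (EXX (-1) false) ?expr1 //; apply/matrixP => i j; rewrite !mxE big_ord1 !mxE /=.
    by rewrite /c /= !mulrA.
- case=> [[] []] [[] []]; rewrite /no_cancel //= => _; rewrite !mxE !big_ord_recr big_ord0 /= !mxE /=.
  all: rewrite ?expr0 ?expr1 ?mulr0 ?mul0r ?mulr1 ?mul1r ?add0r ?addr0 ?mulN1r ?mulrN1 ?opprK.
  all: rewrite ?mulrN ?opprK ?oppr_eq0 -?mulrDr ?mulf_neq0 //.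
Qed.
End OrderTwo.

(** * The case of a specialization of odd order *)

Section Circulant.
Variables (F : fieldType) (m : nat) (s : F).
Local Notation S := (shift m s).

(** In each of the two products only one power of [S] reaches offset [k]; for [k = 0] the second
    product reaches it through [S ^+ m.+1], by wrap-around. *)
Lemma circ_entry (a b c d : F) (i j : 'I_m.+1) k : (k <= m)%N ->
  j = ((i + k) %% m.+1)%N :> nat ->
  ((a%:A + b *: S) * cofac m c d S) i j =
  c ^+ (m - k) * (- d) ^+ k * a * s ^+ k +
  (if k is k'.+1 then c ^+ (m - k') * (- d) ^+ k' * b * s ^+ k
   else (- d) ^+ m * b * s ^+ m.+1).
Proof.
move=> km jE; rewrite mulrDl -!scalerAl mul1r /cofac !mulr_sumr.
have modE l n : (l <= m)%N -> (n <= m)%N ->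
    ((i + n) %% m.+1 == (i + l) %% m.+1)%N = (l == n :> nat).
  by move=> lm nm; rewrite eqn_modDl eq_sym !modn_small.
have mS (l : 'I_m.+1) : (l <= m)%N by rewrite -ltnS.
rewrite mxE mxE summxE mxE summxE; congr (_ + _).
  rewrite (bigD1 (inord k)) //= big1 ?addr0 => [|l].
    rewrite inordK // mxE exprZn mxE shift_exp jE eqxx mulr1n.
    by rewrite [LHS]mulrCA !mulrA; congr (_ * _); rewrite mulrAC.
  rewrite -val_eqE /= inordK // => /negPf lk.
  by rewrite mxE exprZn mxE shift_exp jE modE // lk mulr0n !mulr0.
rewrite mulr_sumr.
have tE (l : 'I_m.+1) : b * (S * (c ^+ (m - l) *: (- d *: S) ^+ l)) i j =
    (b * (c ^+ (m - l) * (- d) ^+ l)) * (s ^+ l.+1 *+ (j == ((i + l.+1) %% m.+1)%N :> nat)).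
  by rewrite exprZn -!scalerAr -exprS !mxE shift_exp !mulrA.
under eq_bigr do rewrite tE jE.
case: k km {jE} => [|k] km.
  rewrite (bigD1 ord_max) //= big1 ?addr0 => [|l].
    by rewrite addn0 modnDr eqxx subnn expr0 mulr1n mul1r [b * _]mulrC.
  rewrite -val_eqE /= => lm; rewrite modE //; last by rewrite ltn_neqAle lm mS.
  by rewrite mulr0n mulr0.
rewrite (bigD1 (inord k)) //= big1 ?addr0 => [|l].
  have kM : (k < m.+1)%N by exact: ltnW.
  by rewrite inordK // eqxx mulr1n [b * _]mulrC.
have kM : (k < m.+1)%N by exact: ltnW.
rewrite -val_eqE /= inordK // => lk.
case: (ltngtP l m) => lm; last 2 first.
- by have := mS l; rewrite leqNgt lm.
(* The last summand wraps around to offset 0, which is not [k.+1]. *)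
- rewrite lm in lk *; rewrite -[(i + m.+1)%N]addn0 -addnA addn0 modnDr -[X in _ == X %[mod _]]addn0.
  by rewrite modE // mulr0n mulr0.
by rewrite modE // eqSS (negPf lk) mulr0n mulr0.
Qed.
(** For positive [k] the two contributions share a monomial and leave the factor [b * c - a * d];
    for [k = 0] the entry is the expression in the last hypothesis. *)
Lemma circ_entry_neq0 (a b c d : F) (i j : 'I_m.+1) k : (k <= m)%N ->
  j = ((i + k) %% m.+1)%N :> nat ->
  c != 0 -> d != 0 -> s != 0 -> b * c != a * d ->
  c ^+ m * a + (- d) ^+ m * b * s ^+ m.+1 != 0 ->
  ((a%:A + b *: S) * cofac m c d S) i j != 0.
Proof.
move=> km jE c0 d0 s0 bc h; rewrite (circ_entry _ _ _ _ km jE).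
case: k km {jE} => [|k] km; first by rewrite subn0 !expr0 !mulr1.
have -> : (m - k)%N = (m - k.+1).+1 by rewrite subnSK.
have -> : c ^+ (m - k.+1) * (- d) ^+ k.+1 * a * s ^+ k.+1 +
    c ^+ (m - k.+1).+1 * (- d) ^+ k * b * s ^+ k.+1 =
    c ^+ (m - k.+1) * (- d) ^+ k * s ^+ k.+1 * (b * c - a * d).
  by rewrite !exprS; ring.
by rewrite !mulf_neq0 ?expf_neq0 ?oppr_eq0 // subr_eq0.
Qed.

End Circulant.

Lemma sum_unity_root (F : fieldType) n (w : F) : w ^+ n = 1 ->
  \sum_(i < n) w ^+ i = (if w == 1 then n%:R else 0).
Proof.
case: eqP => [-> _|/eqP w1 wn].
  by under eq_bigr do rewrite expr1n; rewrite sumr_const card_ord.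
have /eqP := subrX1 w n; rewrite wn subrr eq_sym mulf_eq0 subr_eq0 (negPf w1).
by move=> /eqP.
Qed.

Lemma rank1_delta (F : fieldType) n (f : 'I_n.+1 -> F) k :
  (forall i, i != k -> f i = 0) -> diagf f = (f k *: delta_mx k 0 : 'cV_n.+1) *m delta_mx 0 k.
Proof.
move=> f0; rewrite -scalemxAl mul_delta_mx; apply/matrixP => i j; rewrite !mxE.
have [->|ik] := eqVneq i k; last by rewrite f0 // mul0rn /= ?andFb ?mulr0n ?mulr0.
by rewrite eq_sym; case: eqP => _; rewrite ?mulr1 ?mulr0.
Qed.

Section OddOrder.
Variables (D : unitRingType) (x y q : D) (F : fieldType) (z : F) (m : nat).
Hypothesis div : division_ring D.
Hypotheses (x0 : x != 0) (y0 : y != 0) (q0 : q != 0).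
Hypothesis qN : forall m, (0 < m)%N -> q ^+ m != 1.
Hypotheses (yx : y * x = q * x * y) (qx : GRing.comm q x) (qy : GRing.comm q y).
Hypothesis prim : m.+1.-primitive_root z.
Hypothesis m0 : (0 < m)%N.
Hypothesis compat : forall f : {poly int}, evalz q f = 0 -> evalz z f = 0.

Variable s : F.
Local Notation scal := (@scal_pair D q F z m).
Local Notation tr := (@model_transfer D x y q F z m s%:P).

Let zm : z ^+ m.+1 = 1. Proof. exact: prim_expr_order prim. Qed.

(* The first factor of [u] has a simple pole at [t = - c2^-1], in the entry [ord0]
   only, and a simple zero there, in the entry [ord_max] only; [w] does not cancel
   them, and the entries of [g] and [g^-1] between these two indices are nonzero. *)
Lemma free_conj_pole c c2 w W W' dw dw' f f' a a2 b b2 e e2 :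
  scal c c2 -> c2 != 0 ->
  tr w W dw W' dw' ->
  map_mx (ev (- c2^-1)) W = diagf f -> f ord0 != 0 ->
  map_mx (ev (- c2^-1)) W' = diagf f' -> f' ord_max != 0 ->
  scal a a2 -> scal b b2 -> scal e e2 -> s != 0 ->
  a2 != 0 -> b2 != 0 -> e2 != 0 -> a2 * b2 != e2 ->
  b2 ^+ m.+1 - (- e2) ^+ m.+1 * s ^+ m.+1 != 0 ->
  1 - (- a2) ^+ m.+1 * s ^+ m.+1 != 0 ->
  b2 ^+ m + a2 * (- e2) ^+ m * s ^+ m.+1 != 0 ->
  b2 + e2 * (- a2) ^+ m * s ^+ m.+1 != 0 ->
  let u := (1 + (c * q) * x) * (1 + c * x)^-1 * w in
  let g := (1 + a * y) * (b + e * y)^-1 in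
  free_pair u (g^-1 * u * g).
Proof.
move=> cc c20 Tw WE f0 WE' f'0 aa bb ee s0 a20 b20 e20 abe h1 h2 h3 h4 u g.
set t0 := - c2^-1.
have one0 : (1 : F) != 0 by exact: oner_neq0.
have s1 : scal 1 1 by exact: scal_pair1.
have cq := scal_pairM s%:P div q0 yx qx qy zm cc (scal_pair_q q z m).
have Tn := model_transfer_quotx s%:P div x0 y0 q0 qN yx qx qy zm compat s1 cq one0 s1 cc one0.
have dl b' e' : b' ^+ m.+1 - (- e') ^+ m.+1 * s ^+ m.+1 != 0 -> cofac_scal m b' e' s%:P != 0.
  move=> h; apply/negP => /eqP /(congr1 (fun p => p.[0])).
  by rewrite ev_cofac_scal hornerC horner0 => /eqP; rewrite (negPf h).
have dl1 := dl _ _ h1.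
have dl2 : cofac_scal m 1 a2 s%:P != 0 by apply: dl; rewrite expr1n.
have Tg := model_transfer_quoty div x0 y0 q0 qN yx qx qy zm compat s1 aa one0 bb ee b20 dl2 dl1.
have Tu := transfer2M div Tn Tw.
have Tv := transfer2M div (transfer2M div (transfer2V div Tg) Tu) Tg.
have n0 : (m.+1%:R : F) != 0 by exact: prim_root_natf_neq0 prim.
have zk k : (0 < k)%N -> (k <= m)%N -> z ^+ k == 1 = false.
  by move=> k0 km; rewrite -(prim_order_dvd prim) gtnNdvd.
have z1 : z == 1 = false by rewrite -(expr1 z) zk.
(* Entries at [t0] of the first factor of [u] and of its inverse. The sum of the first [m.+1] powers
   of an [m.+1]-th root of unity vanishes unless the root is 1, which leaves index 0 in [f1] and
   index [m] in [f1']. *)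
pose f1 (i : 'I_m.+1) := (1 - z ^+ i.+1) * \sum_(l < m.+1) (z ^+ i) ^+ l.
pose f1' (i : 'I_m.+1) := (1 - z ^+ i) * \sum_(l < m.+1) (z ^+ i.+1) ^+ l.
have unity k : (z ^+ k) ^+ m.+1 = 1 by rewrite exprAC zm expr1n.
have f1_0 (i : 'I_m.+1) : i != ord0 -> f1 i = 0.
  move=> i0; rewrite /f1 sum_unity_root // zk ?mulr0 //; last by rewrite -ltnS.
  by rewrite lt0n; apply: contra i0 => /eqP h; apply/eqP/val_inj.
have f1'_0 (i : 'I_m.+1) : i != ord_max -> f1' i = 0.
  move=> im; rewrite /f1' sum_unity_root // zk ?mulr0 //.
  by rewrite ltn_neqAle -ltnS ltn_ord andbT; apply: contra im => /eqP h; apply/eqP/val_inj.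
have f10 : f1 ord0 != 0.
  by rewrite /f1 sum_unity_root // expr0 eqxx mulf_neq0 // expr1 subr_eq0 eq_sym z1.
have f1m : f1' ord_max != 0.
  rewrite /f1' sum_unity_root // zm eqxx mulf_neq0 // subr_eq0 eq_sym.
  by rewrite zk.
have ct0 : c2 * t0 = -1 by rewrite mulrN divff.
have evn : map_mx (ev t0) ((cst_mx m 1 + (c2 * z)%:P *: clock_mx z m) * cofac m 1%:P c2%:P (clock_mx z m)) = diagf f1.
  rewrite ev_quotx; apply: eq_diagf => i; rewrite /f1; congr (_ * _).
    by rewrite mulrACA ct0 mulN1r exprS.
  by apply: eq_bigr => l _; rewrite expr1n mul1r mulNr mulrA ct0 mulN1r opprK.
have evn' : map_mx (ev t0) ((cst_mx m 1 + c2%:P *: clock_mx z m) * cofac m 1%:P (c2 * z)%:P (clock_mx z m)) = diagf f1'.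
  rewrite ev_quotx; apply: eq_diagf => i; rewrite /f1'; congr (_ * _).
    by rewrite mulrA ct0 mulN1r.
  apply: eq_bigr => l _; rewrite expr1n mul1r mulNr mulrACA ct0 mulN1r opprK.
  by rewrite -exprS.
pose S := shift m s.
(* Images of [g] and [g^-1] cleared of denominators. The parameter of the shift is here the constant
   [s], so they do not depend on the evaluation point. *)
pose Gp := ((1 : F)%:A + a2 *: S) * cofac m b2 e2 S.
pose Gm := (b2%:A + e2 *: S) * cofac m 1 a2 S.
have evGp : map_mx (ev t0) ((cst_mx m 1 + a2%:P *: shift_mx m s%:P) * cofac m b2%:P e2%:P (shift_mx m s%:P)) = Gp.
  by rewrite ev_quoty hornerC.
have evGm : map_mx (ev t0) ((cst_mx m b2 + e2%:P *: shift_mx m s%:P) * cofac m 1%:P a2%:P (shift_mx m s%:P)) = Gm.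
  by rewrite ev_quoty hornerC.
pose k0 (b : bool) : 'I_m.+1 := if b then ord_max else ord0.
pose al (b : bool) := if b then f' ord_max * f1' ord_max else f1 ord0 * f ord0.
have al0 b' : al b' != 0 by case: b'; rewrite /al mulf_neq0.
pose colu b : 'cV[F]_m.+1 := al b *: delta_mx (k0 b) 0.
pose rowu b : 'rV[F]_m.+1 := delta_mx 0 (k0 b).
(* A letter of [v] is a conjugated letter of [u]: [Gm] acts on its column and [Gp] on its row. *)
pose col (p : bool * bool) := if p.1 then Gm *m colu p.2 else colu p.2.
pose row (p : bool * bool) := if p.1 then rowu p.2 *m Gp else rowu p.2.
have evu b' : map_mx (ev t0) (if b' then W' * ((cst_mx m 1 + c2%:P *: clock_mx z m) * cofac m 1%:P (c2 * z)%:P (clock_mx z m))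
   else (cst_mx m 1 + (c2 * z)%:P *: clock_mx z m) * cofac m 1%:P c2%:P (clock_mx z m) * W) = colu b' *m rowu b'.
  case: b'; [rewrite (map_mulmx2 WE' evn')|rewrite (map_mulmx2 evn WE)]; rewrite diagfM /colu /rowu.
    by apply: rank1_delta => i ii; rewrite f1'_0 // mulr0.
  by apply: rank1_delta => i ii; rewrite f1_0 // mul0r.
have dlc : (cofac_scal m 1 c2 'X).[t0] = 0.
  by rewrite ev_cofac_scal hornerX expr1n -exprMn [- c2 * t0]mulNr ct0 opprK expr1n subrr.
have dlcz : (cofac_scal m 1 (c2 * z) 'X).[t0] = 0.
  by rewrite ev_cofac_scal hornerX expr1n -exprMn [_ * t0]mulNr mulrAC ct0 mulN1r opprK zm subrr.
apply: (model_transfer_free div x0 y0 q0 qN yx qx qy zm compat (t0 := t0) Tu Tv (col := col) (row := row)).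
1-4: by rewrite !hornerM ?dlc ?dlcz ?(mulr0, mul0r).
- case=> [[] []] /=; [rewrite mulrA| |exact: (evu true)|exact: (evu false)].
  + rewrite (map_mulmx2 (map_mulmx2 evGm (evu true)) evGp) /col /row /=.
    by rewrite -!mulmxE !mulmxA.
  + rewrite (map_mulmx2 (map_mulmx2 evGm (evu false)) evGp) /col /row /=.
    by rewrite -!mulmxE !mulmxA.
- have entry b1 b2' (M : 'M[F]_m.+1) : (rowu b1 *m M *m colu b2') 0 0 = al b2' * M (k0 b1) (k0 b2').
    by rewrite /rowu /colu -scalemxAr mxE -rowE -colE !mxE.
  (* The offsets between [ord0] and [ord_max] modulo [m.+1] are 0, 1 and [m], all within reach of
     [circ_entry_neq0]. *)
  have kk b1 b2' : exists2 k, (k <= m)%N & k0 b2' = ((k0 b1 + k) %% m.+1)%N :> nat.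
    case: b1; case: b2' => /=.
    + by exists 0%N; rewrite // addn0 modn_small.
    + by exists 1%N; rewrite // addn1 modnn.
    + by exists m; rewrite // add0n modn_small.
    + by exists 0%N; rewrite // addn0 modn_small.
  have Gp0 b1 b2' : Gp (k0 b1) (k0 b2') != 0.
    have [k km kE] := kk b1 b2'; apply: (circ_entry_neq0 km kE) => //.
      by rewrite mul1r.
    by rewrite mulr1 [_ * a2]mulrC.
  have Gm0 b1 b2' : Gm (k0 b1) (k0 b2') != 0.
    have [k km kE] := kk b1 b2'; apply: (circ_entry_neq0 km kE) => //.
      by rewrite mulr1 mulrC eq_sym.
    by rewrite expr1n mul1r [_ * e2]mulrC.
  case=> [v1 b1] [v2 b2']; rewrite /no_cancel /row /col.
  case: v1 v2 => [] [] /=; rewrite ?andbF ?andbT /=.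
  + rewrite negbK => /eqP <-; rewrite mulmxA -[rowu b1 *m _ *m _]mulmxA.
    (* Between two letters of [v] the conjugating matrices meet, and their product is a nonzero
       scalar. *)
    have -> : Gp *m Gm = ((b2 ^+ m.+1 - (- e2) ^+ m.+1 * s ^+ m.+1) * (1 - (- a2) ^+ m.+1 * s ^+ m.+1))%:A.
      rewrite mulmxE /Gp /Gm mulrA -[_ * cofac m b2 e2 S * _]mulrA (cofacC _ _ (shift_expn _ _)).
      by rewrite -scalerAr mulr1 -scalerAl (cofacP _ _ (shift_expn _ _)) expr1n scalerA.
    by rewrite entry !mxE eqxx mulr1n mulr1 !mulf_neq0.
  + by move=> _; rewrite entry mulf_neq0.
  + by move=> _; rewrite mulmxA entry mulf_neq0.
  + rewrite negbK => /eqP <-; have := entry b1 b1 1%:M; rewrite mulmx1 => ->.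
    by rewrite mxE eqxx mulr1.
Qed.

End OddOrder.

(** * Specializing a non-torsion element to a root of unity *)

(* There are finitely many remainders modulo [f]. *)
Lemma Fp_poly_period (F : finFieldType) (f : {poly F}) : f != 0 ->
  exists i j, (i < j)%N /\ f %| 'X^i - 'X^j.
Proof.
move=> f0; pose T : finType := 'rV[F]_(size f).
pose h (i : 'I_#|T|.+1) : T := poly_rV ('X^i %% f).
have : ~~ injectiveb h.
  by apply/injectiveP => /leq_card; rewrite card_ord ltnn.
move=> /injectivePn [i [j ij hij]].
have E : 'X^i %% f = 'X^j %% f.
  by rewrite -[LHS](poly_rV_K (d := size f)) ?[RHS]poly_rV_K -?/(h _) ?hij ?poly_rV_K // ltnW // ltn_modp.
have dv (a b : nat) : 'X^a %% f = 'X^b %% f -> f %| 'X^a - 'X^b.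
  by move=> ab; rewrite /dvdp modpD modpN ab subrr.
case: (ltngtP i j) => [lt|gt|/val_inj eq].
- by exists i, j; split=> //; exact: dv.
- by exists j, i; split=> //; exact: dv.
- by rewrite eq eqxx in ij.
Qed.

Section PChar.
Variables (p : nat) (pp : prime p).

Lemma intr_Fp_eq0 (n : int) : ((n%:~R : 'F_p) == 0) = (p %| `|n|)%N.
Proof.
rewrite (dvdn_pcharf (pchar_Fp pp)); case: n => n //=.
by rewrite -[(Negz n)%:~R]/(- n.+1%:R) oppr_eq0.
Qed.

Lemma intr_pchar_eq0 (R : nzRingType) (n : int) : (p%:R : R) = 0 ->
  (n%:~R : 'F_p) = 0 -> (n%:~R : R) = 0.
Proof.
move=> pR /eqP; rewrite intr_Fp_eq0 => /dvdnP[k nE].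
have h : ((`|n|%N)%:R : R) = 0 by rewrite nE natrM pR mulr0.
by case: n {nE} h => n //= h; rewrite -[(Negz n)%:~R]/(- n.+1%:R) h oppr0.
Qed.

Lemma evalz_pchar (R : nzRingType) (a : R) (f : {poly int}) : (p%:R : R) = 0 ->
  map_poly (intr : int -> 'F_p) f = 0 -> evalz a f = 0.
Proof.
move=> pR f0; rewrite /= /horner_morph.
suff -> : map_poly (intr : int -> R) f = 0 by rewrite horner0.
apply/polyP => i; rewrite coef0 coef_map; apply: intr_pchar_eq0 => //.
by have := congr1 (fun g : {poly 'F_p} => g`_i) f0; rewrite coef0 coef_map.
Qed.

(** Over a finite field every nonzero polynomial divides a nontrivial ['X^i - 'X^j], so a unit that
    is a root of it would have finite order. *)
Lemma pchar_transcendental (R : unitRingType) (q : R) (f : {poly int}) :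
  (p%:R : R) = 0 -> q \is a GRing.unit -> (forall m, (0 < m)%N -> q ^+ m != 1) ->
  evalz q f = 0 -> map_poly (intr : int -> 'F_p) f = 0.
Proof.
move=> pR uq qN fq; apply/eqP/negPn/negP => /Fp_poly_period [i [j [ij /dvdpP [g gE]]]].
(* Evaluation at [q] takes integer polynomials only, so the quotient [g] is lifted to [G]; the
   resulting error vanishes modulo [p], hence at [q]. *)
pose G : {poly int} := map_poly (fun a : 'F_p => (a : nat)%:Z) g.
have GE : map_poly (intr : int -> 'F_p) G = g.
  apply/polyP => k; rewrite coef_map coef_map_id0 //=; exact: natr_Zp.
have : evalz q ('X^i - 'X^j - G * f) = 0.
  apply: evalz_pchar => //.
  by rewrite !rmorphB rmorphM /= GE !map_polyXn gE subrr.
rewrite !rmorphB rmorphM fq mulr0 subr0 !rmorphXn evalzX => /eqP.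
rewrite subr_eq0 -(subnKC (ltnW ij)) exprD -{1}[q ^+ i]mulr1 (inj_eq (mulrI (unitrX i uq))) => /eqP E.
by move: (qN (j - i)%N); rewrite subn_gt0 ij -E eqxx => /(_ isT).
Qed.

End PChar.

Lemma division_ring_pchar (D : unitRingType) n : division_ring D -> (0 < n)%N ->
  (n%:R : D) = 0 -> exists2 p, prime p & (p%:R : D) = 0.
Proof.
move=> div; elim/ltn_ind: n => n IH n0 nD.
case: (leqP n 1) => n1.
  have n1E : n = 1%N by apply/eqP; rewrite eqn_leq n1.
  by move/eqP: nD; rewrite n1E oner_eq0.
have pp := pdiv_prime n1; have /dvdnP[k nE] := pdiv_dvd n.
case: (eqVneq (pdiv n)%:R (0 : D)) => [pD|pD]; first by exists (pdiv n).
move: nD; rewrite {1}nE natrM => /(div_mul_eq0 div) /(_ pD) kD.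
have k0 : (0 < k)%N by case: k nE {kD} => //; rewrite mul0n => nE; rewrite nE in n0.
by apply: (IH k _ k0 kD); rewrite nE ltn_Pmulr // prime_gt1.
Qed.

Lemma primitive_root_exists (F : fieldType) (z : F) i j : (i < j)%N -> z ^+ i = z ^+ j ->
  z != 0 -> z != 1 -> exists n, (1 < n)%N /\ n.-primitive_root z.
Proof.
move=> ij E z0 z1.
have : z ^+ (j - i) = 1.
  by apply: (mulfI (expf_neq0 i z0)); rewrite mulr1 -exprD subnKC // ltnW.
have ji : (0 < j - i)%N by rewrite subn_gt0.
move=> /(prim_order_exists ji) [n pn _]; exists n; split=> //.
rewrite ltn_neqAle (prim_order_gt0 pn) andbT; apply: contraNN z1 => /eqP n1.
by have := prim_expr_order pn; rewrite -n1 expr1 => ->.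
Qed.

Lemma primitive_root_N1 (F : fieldType) : (2%:R : F) != 0 -> 2.-primitive_root (-1 : F).
Proof.
move=> F2; have m1 : (-1 : F) != 1.
  by rewrite eq_sym -subr_eq0 opprK.
have zm : (-1 : F) ^+ 2 = 1 by rewrite sqrrN expr1n.
have [n pn nd] := prim_order_exists (isT : (0 < 2)%N) zm.
have : (n <= 2)%N by exact: dvdn_leq nd.
have := prim_order_gt0 pn.
case: n pn {nd} => [|[|[|n]]] // pn.
by have := prim_expr_order pn; rewrite expr1 => /eqP; rewrite (negPf m1).
Qed.

Section Specialization.
Variables (D : unitRingType) (q : D).
Hypothesis div : division_ring D.
Hypotheses (D2 : (2%:R : D) != 0) (q0 : q != 0).
Hypothesis qN : forall m, (0 < m)%N -> q ^+ m != 1.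

(** The last clause makes [q] to [z] a well-defined ring map on integer polynomials in [q]. The
    condition on 3 serves [core_odd_inverted], which needs 4 to differ from 1 in [F]. *)
Definition specializes (F : closedFieldType) (z : F) n :=
  [/\ (1 < n)%N, n.-primitive_root z, (2%:R : F) != 0, (odd n -> (3%:R : F) != 0)
    & forall f : {poly int}, evalz q f = 0 -> evalz z f = 0].

Lemma Fp_closure p : prime p -> exists (F : closedFieldType) (h : {rmorphism 'F_p -> F}),
  forall n : int, ((n%:~R : F) == 0) = (p %| `|n|)%N.
Proof.
move=> pp; have [K [h _]] := countable_algebraic_closure 'F_p.
exists K, h => n; rewrite -intr_Fp_eq0 // -(fmorph_eq0 h).
by rewrite rmorph_int.
Qed.

(** In characteristic [p] an element of infinite order is transcendental over the prime field, so
    every [z] is a specialization; -1 has order 2 because [p] is odd. *)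
Lemma specialization_pchar p : prime p -> (p%:R : D) = 0 ->
  exists (F : closedFieldType) (z : F) n, specializes z n.
Proof.
move=> pp pD; have [F [h Fp]] := Fp_closure pp.
have p2 : p != 2%N by apply: contraNneq D2 => <-; rewrite pD.
have F2 : (2%:R : F) != 0.
  by rewrite (Fp 2%:Z) /= dvdn_prime2.
exists F, (-1), 2%N; split=> //; first exact: primitive_root_N1.
move=> f /(pchar_transcendental pp pD (div q0) qN) f0; apply: evalz_pchar f0 => //.
by apply/eqP; rewrite (Fp p%:Z) /= dvdnn.
Qed.

(* Reduce a minimal integer polynomial of [q] modulo a large prime. *)
Lemma specialization_algebraic (f0 : {poly int}) :
  (forall n, (0 < n)%N -> (n%:R : D) != 0) -> f0 != 0 -> evalz q f0 = 0 ->
  exists (F : closedFieldType) (z : F) n, specializes z n.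
Proof.
move=> D0 f00 f0q.
have D0z (n : int) : n != 0 -> (n%:~R : D) != 0.
  by case: n => [n|n] n0; [apply: D0; rewrite lt0n | rewrite -[(Negz n)%:~R]/(- n.+1%:R) oppr_eq0; exact: D0].
have [f [f_neq0 fq fmin]] : exists f : {poly int}, [/\ f != 0, evalz q f = 0 &
    forall g : {poly int}, evalz q g = 0 -> (size g < size f)%N -> g = 0].
  have [n] := ubnP (size f0); elim: n f0 f00 f0q => // n IH f f_neq0 fq; rewrite ltnS => sf.
  case: (classic (exists g : {poly int}, [/\ g != 0, evalz q g = 0 & (size g < size f)%N])).
    by move=> [g [g0 gq gs]]; apply: (IH g g0 gq); exact: leq_trans gs sf.
  move=> H; exists f; split=> // g gq gs; apply/eqP/negPn/negP => g0.
  by apply: H; exists g.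
(* A linear factor that does not vanish at [q] could be divided out, against minimality. *)
have noroot (a : int) : q - a%:~R != 0 -> f.[a] != 0.
  move=> qa; apply/negP => /factor_theorem [g gE].
  have g0 : g != 0 by apply: contraNneq f_neq0 => g0; rewrite gE g0 mul0r.
  have : g = 0.
    apply: fmin; last by rewrite gE size_Mmonic ?monicXsubC // size_XsubC addn2.
    by move: fq; rewrite gE rmorphM rmorphB evalzX evalzC => /(div_mul_eq0 div); apply.
  by move/eqP; rewrite (negPf g0).
have r0 : f.[0] != 0 by apply: noroot; rewrite mulr0z subr0.
have r1 : f.[1] != 0 by apply: noroot; rewrite subr_eq0; exact: (qN (m := 1)).
have lc0 : lead_coef f != 0 by rewrite lead_coef_eq0.
(* A prime above [M] divides none of these factors: 6 keeps 2 and 3 nonzero, [f.[0]] and [f.[1]]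
   keep the roots away from 0 and 1, and the leading coefficient preserves the degree. *)
pose M := (6 * `|f.[0]| * `|f.[1]| * `|lead_coef f|)%N.
have [p Mp pp] := prime_above M.
have [F [h Fp]] := Fp_closure pp.
have nz (n : int) : (`|n| %| M)%N -> n != 0 -> (n%:~R : F) != 0.
  move=> nM n0; rewrite Fp; apply/negP => pn.
  have M0 : (0 < M)%N by rewrite !muln_gt0 !absz_gt0 r0 r1 lc0.
  have := dvdn_leq M0 (dvdn_trans pn nM); by rewrite leqNgt Mp.
have F2 : (2%:R : F) != 0.
  by apply: (nz 2%:Z) => //; rewrite /M -!mulnA; apply: dvdn_mulr.
have F3 : (3%:R : F) != 0.
  by apply: (nz 3%:Z) => //; rewrite /M -!mulnA; apply: dvdn_mulr.
have Fr0 : (f.[0]%:~R : F) != 0.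
  by apply: nz => //; rewrite /M; do 2 apply: dvdn_mulr; exact: dvdn_mull.
have Fr1 : (f.[1]%:~R : F) != 0.
  by apply: nz => //; rewrite /M; apply: dvdn_mulr; exact: dvdn_mull.
have Flc : ((lead_coef f)%:~R : F) != 0 by apply: nz => //; exact: dvdn_mull.
pose fF := map_poly (intr : int -> F) f.
have sfF : size fF = size f by apply: size_map_poly_id0.
have sf1 : size f != 1%N.
  apply/negP => /size_poly1P [c c0 fE]; move: fq; rewrite fE evalzC => /eqP.
  by rewrite (negPf (D0z _ c0)).
have [z zroot] : exists z, root fF z by apply/closed_rootP; rewrite sfF.
have fz : evalz z f = 0 by move/rootP: zroot.
have z_neq (a : int) : (f.[a]%:~R : F) != 0 -> z != a%:~R.
  apply: contraNneq => zE; move: fz; rewrite zE /= /horner_morph.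
  by rewrite (horner_map (intr : {rmorphism int -> F})) => ->.
have z0 : z != 0 by have := z_neq 0 Fr0; rewrite mulr0z.
have z1 : z != 1 by have := z_neq 1 Fr1.
have fp0 : map_poly (intr : int -> 'F_p) f != 0.
  apply: contraNneq Flc => fp0; rewrite lead_coefE -[X in X%:~R]/(f`_(size f).-1).
  have := congr1 (fun g : {poly 'F_p} => h g`_(size f).-1) fp0.
  by rewrite coef_map coef0 rmorph0 rmorph_int => ->.
have [i [j [ij]]] := Fp_poly_period fp0.
have hf : map_poly h (map_poly (intr : int -> 'F_p) f) = fF.
  by rewrite -map_poly_comp; apply: eq_map_poly => n /=; rewrite rmorph_int.
rewrite -(dvdp_map h) hf rmorphB /= !map_polyXn => /dvdpP [g gE].
have zij : z ^+ i = z ^+ j.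
  apply/eqP; rewrite -subr_eq0; have := congr1 (fun g : {poly F} => g.[z]) gE.
  by rewrite !hornerE (rootP zroot) mulr0 => ->.
have [n [n1 pn]] := primitive_root_exists ij zij z0 z1.
exists F, z, n; split=> // k kq.
(* Pseudo-division: the remainder vanishes at [q], so it is zero by minimality, and the power of the
   leading coefficient multiplying [k] is nonzero in [F]. *)
have Ek := Pdiv.ComRing.rdivp_eq f k.
have rq : Pdiv.Ring.rmodp k f = 0.
  apply: fmin; last exact: Pdiv.Ring.ltn_rmodpN0.
  move: (congr1 (evalz q) Ek); rewrite -mul_polyC !rmorphD !rmorphM kq fq !mulr0 add0r.
  by move=> <-.
move: (congr1 (evalz z) Ek); rewrite rq addr0 -mul_polyC !rmorphM fz mulr0 evalzC rmorphXn => /eqP.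
by rewrite mulf_eq0 expf_eq0 (negPf Flc) andbF /= => /eqP.
Qed.

Lemma specialization : exists (F : closedFieldType) (z : F) n, specializes z n.
Proof.
case: (classic (exists n, (0 < n)%N /\ (n%:R : D) = 0)) => [[n [n0 nD]]|H].
  by have [p pp pD] := division_ring_pchar div n0 nD; exact: specialization_pchar pp pD.
have D0 n : (0 < n)%N -> (n%:R : D) != 0.
  by move=> n0; apply/eqP => nD; apply: H; exists n.
case: (classic (exists f : {poly int}, f != 0 /\ evalz q f = 0)) => [[f [f0 fq]]|H'].
  exact: specialization_algebraic D0 f0 fq.
(* Characteristic zero with [q] transcendental: any root of unity is a specialization. *)
exists algC, (-1), 2%N; split=> //; first by apply: primitive_root_N1; rewrite Num.Theory.pnatr_eq0.
  by rewrite Num.Theory.pnatr_eq0.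
move=> f fq; have [->|f0] := eqVneq f 0; first by rewrite rmorph0.
by case: H'; exists f.
Qed.

End Specialization.

(** * Symmetric elements of normal subgroups *)

Lemma evalz_compX (R : nzRingType) (a : R) k f : evalz a (f \Po 'X^k) = evalz (a ^+ k) f.
Proof.
rewrite comp_polyE rmorph_sum /= {2}/horner_morph (horner_coef_wide _ (size_poly _ _)).
apply: eq_bigr => i _; rewrite coef_map -mul_polyC.
rewrite -/(evalz a _) rmorphM /= -/(evalz a _) evalzC; congr (_ * _).
by rewrite -/(evalz a ('X^k ^+ i)) !rmorphXn /= -/(evalz a _) evalzX.
Qed.

(** Multiplied by [w - 1], the sum becomes [w ^+ n - 1 = -2]. *)
Lemma sum_pow_neg (F : fieldType) n (w : F) : (2%:R : F) != 0 -> w ^+ n = -1 ->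
  \sum_(i < n) w ^+ i != 0.
Proof.
move=> F2 wn; apply/eqP => s0; have := subrX1 w n; rewrite s0 mulr0 wn -opprD => /eqP.
by rewrite oppr_eq0; rewrite -[1 + 1]/(2%:R) (negPf F2).
Qed.

(** Each condition, needed in [free_conj_pole], excludes the roots of a nonzero polynomial in [s],
    and over an algebraically closed field a nonzero polynomial has a nonroot. *)
Lemma generic_shift (F : closedFieldType) m (a b e : F) :
  a != 0 -> b != 0 -> e != 0 -> exists s : F, [/\ s != 0,
  b ^+ m.+1 - (- e) ^+ m.+1 * s ^+ m.+1 != 0,
  1 - (- a) ^+ m.+1 * s ^+ m.+1 != 0,
  b ^+ m + a * (- e) ^+ m * s ^+ m.+1 != 0 &
  b + e * (- a) ^+ m * s ^+ m.+1 != 0].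
Proof.
move=> a0 b0 e0; pose p (c d : F) : {poly F} := c%:P + d%:P * 'X^(m.+1).
have p0 c d : c != 0 -> p c d != 0.
  move=> c0; apply/negP => /eqP /(congr1 (fun r => r.[0])).
  by rewrite !hornerE expr0n mulr0 addr0 => /eqP; rewrite (negPf c0).
have pE c d s : (p c d).[s] = c + d * s ^+ m.+1 by rewrite !hornerE.
have : 'X * p (b ^+ m.+1) (- (- e) ^+ m.+1) * p 1 (- (- a) ^+ m.+1) *
       p (b ^+ m) (a * (- e) ^+ m) * p b (e * (- a) ^+ m) != 0.
  by rewrite !mulf_neq0 ?polyX_eq0 ?p0 ?expf_neq0 ?oner_neq0.
move=> /closed_nonrootP [s]; rewrite /root !hornerM hornerX !pE !mulf_eq0 !negb_or !mulNr.
by move=> /andP[/andP[/andP[/andP[s0 h1] h2] h3] h4]; exists s.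
Qed.

Section Involution.
Variables (D : unitRingType) (star : D -> D) (N : D -> Prop).
Hypothesis div : division_ring D.
Hypothesis inv : k_involution star.
Hypotheses (norN : normal_in_units N) (starN : star_stable star N).

Let starD a b : star (a + b) = star a + star b. Proof. by case: inv. Qed.
Let starM a b : star (a * b) = star b * star a. Proof. by case: inv. Qed.
Let starK a : star (star a) = a. Proof. by case: inv. Qed.

Lemma star0 : star 0 = 0.
Proof. by apply: (addrI (star 0)); rewrite -starD !addr0. Qed.

Lemma star1 : star 1 = 1.
Proof. by rewrite -[star 1]mulr1 -{2}[1]starK -starM mulr1 starK. Qed.

Lemma starn n : star n%:R = n%:R.
Proof. by elim: n => [|n IH]; rewrite ?star0 // mulrS starD star1 IH. Qed.

Lemma starNr a : star (- a) = - star a.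
Proof. by apply: (addrI (star a)); rewrite -starD !subrr star0. Qed.

Lemma star_neq0 a : a != 0 -> star a != 0.
Proof. by apply: contraNneq => a0; rewrite -[a]starK a0 star0. Qed.

Lemma starV a : star a^-1 = (star a)^-1.
Proof.
have [->|a0] := eqVneq a 0; first by rewrite invr0 star0 invr0.
have ua := div a0; have us := div (star_neq0 a0).
by apply: (mulrI us); rewrite -starM mulVr // star1 divrr.
Qed.

Lemma N_star a : N a -> N (star a).
Proof. by move=> Na; apply/starN; exists a. Qed.

Lemma N_conj a b : N a -> b != 0 -> N (b^-1 * a * b).
Proof. by case: norN => _; exact. Qed.

Lemma N_mul a b : N a -> N b -> N (a * b).
Proof. by case: norN => [[_ _ h _] _]; exact: h. Qed.

Lemma N_inv a : N a -> N a^-1.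
Proof. by case: norN => [[_ _ _ h] _]; exact: h. Qed.

Lemma inv_neq0 (a : D) : a != 0 -> a^-1 != 0.
Proof. by move=> /div ua; apply/eqP => E; move: ua; rewrite -unitrV E unitr0. Qed.

Lemma mul_neq0 (a b : D) : a != 0 -> b != 0 -> a * b != 0.
Proof. by move=> a0 b0; apply/eqP => /(div_mul_eq0 div) /(_ b0) /eqP; rewrite (negPf a0). Qed.

(* The commutator of [y] and [1 + c x]. *)
Lemma N_quot x y q c : y != 0 -> N y -> y * x = q * x * y ->
  GRing.comm c y -> 1 + c * x != 0 ->
  N ((1 + c * q * x) * (1 + c * x)^-1).
Proof.
move=> y0 Ny yx cy l0.
have -> : (1 + c * q * x) * (1 + c * x)^-1 =
    y * ((1 + c * x)^-1^-1 * y^-1 * (1 + c * x)^-1).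
  rewrite invrK !mulrA; congr (_ * _); rewrite mulrDr mulr1 [y * (c * x)]mulrA -cy -[c * y * x]mulrA yx.
  have -> : y + c * (q * x * y) = (1 + c * q * x) * y by rewrite mulrDl mul1r !mulrA.
  by rewrite mulrK // div.
by apply: N_mul => //; apply: N_conj; [exact: N_inv|exact: inv_neq0].
Qed.

Lemma comm_quot (a b : D) : GRing.comm a b -> a^-1 * b = b * a^-1.
Proof. by move=> ab; apply: commr_sym; apply: commrV; exact: commr_sym. Qed.

Lemma comm_affine (w a b c d : D) : GRing.comm a w -> GRing.comm b w -> GRing.comm c w ->
  GRing.comm d w -> GRing.comm a c -> GRing.comm a d -> GRing.comm b c -> GRing.comm b d ->
  GRing.comm (a + b * w) (c + d * w).
Proof.
move=> aw bw cw dw ac ad bc bd.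
have h e : GRing.comm e w -> GRing.comm e c -> GRing.comm e d -> GRing.comm (c + d * w) e.
  by move=> ew ec ed; apply: commr_sym; apply: commrD => //; exact: commrM.
apply: commr_sym; apply: commrD; first exact: h.
by apply: commrM; apply: h => //; exact: commr_sym.
Qed.

Lemma star_quot w c d : star w = w -> GRing.comm (star c) w -> GRing.comm (star d) w ->
  GRing.comm (star c) (star d) ->
  star ((1 + c * w) * (1 + d * w)^-1) = (1 + star c * w) * (1 + star d * w)^-1.
Proof.
move=> sw cw dw cd; rewrite starM starV !starD !starM star1 sw -cw -dw.
apply: comm_quot; apply: comm_affine => //.
all: by [exact: commr1|exact: commr_sym (commr1 _)|exact: commr_sym].
Qed.

(** When [star w = w^-1], the involution turns [a + b * w] into [star b + star a * w] times [w^-1]: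
    coefficients are swapped, and the powers of [w] cancel in the quotient. *)
Lemma star_quotV w e c d f : w != 0 -> star w = w^-1 ->
  GRing.comm (star e) w -> GRing.comm (star c) w -> 
  GRing.comm (star d) w -> GRing.comm (star f) w ->
  GRing.comm (star e) (star d) -> GRing.comm (star e) (star f) ->
  GRing.comm (star c) (star d) -> GRing.comm (star c) (star f) ->
  d + f * w != 0 -> 
  star ((e + c * w) * (d + f * w)^-1) = (star c + star e * w) * (star f + star d * w)^-1.
Proof.
move=> w0 sw ew cw dw fw ed ef cd cf n0.
have uw := div w0.
have E (a b : D) : GRing.comm (star b) w -> star (a + b * w) = (star b + star a * w) * w^-1.
  move=> bw; rewrite starD starM sw mulrDl mulrK // addrC.
  by rewrite (comm_quot (commr_sym bw)).
have uE : star f + star d * w \is a GRing.unit.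
  have := div (star_neq0 n0); rewrite E //.
  by rewrite unitrMl // unitrV.
rewrite starM starV !E // invrM ?unitrV // invrK.
have c1 : GRing.comm w (star f + star d * w).
  by apply: commrD; [exact: commr_sym|apply: commrM; [exact: commr_sym|exact: commr_refl]].
have c2 : GRing.comm (star c + star e * w) (star f + star d * w).
  by apply: comm_affine => //; exact: commr_sym.
have c3 : GRing.comm w (star c + star e * w).
  by apply: commrD; [exact: commr_sym|apply: commrM; [exact: commr_sym|exact: commr_refl]].
rewrite -!mulrA [_ * ((star c + _) * w^-1)]mulrA (comm_quot (commr_sym c2)).
rewrite !mulrA c3 -!mulrA; congr (_ * _).
rewrite !mulrA (commrV c1) -mulrA divrr // mulr1 //.
Qed.

(** If [c * x] were -1 it would commute with [y], whereas [y] moves past it with a factor [q]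
    different from 1. *)
Lemma affine_neq0 (x y q c : D) : y != 0 -> y * x = q * x * y -> GRing.comm c y -> GRing.comm c q ->
  q != 1 -> 1 + c * x != 0.
Proof.
move=> y0 yx cy cq q1; apply/eqP => E; move/eqP: q1; apply.
have cx : c * x = -1 by apply/eqP; rewrite -addr_eq0 addrC E.
have h : (q - 1) * y = 0.
  apply: oppr_inj; rewrite mulrBl mul1r opprB oppr0.
  have : y * (c * x) = q * (c * x) * y.
    by rewrite mulrA -cy -mulrA yx !mulrA cq.
  by rewrite cx mulrN1 mulrN1 mulNr => /eqP; rewrite eqr_opp => /eqP {1}->; rewrite subrr.
by move/(div_mul_eq0 div): h => /(_ y0) /eqP; rewrite subr_eq0 => /eqP.
Qed.

(** When [w] is inverted, [star c] is pulled out to bring the constant term of the numerator back to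
    1; this is the scalar in the middle of [norm_mobius]. *)
Lemma star_mobius (w c : D) (b : bool) : w != 0 -> star w = (if b then w else w^-1) ->
  GRing.comm (star c) w -> c != 0 -> 1 + 1 * w != 0 ->
  star ((1 + c * w) * (1 + 1 * w)^-1) =
  (if b then 1 else star c) * ((1 + (if b then star c else (star c)^-1) * w) * (1 + 1 * w)^-1).
Proof.
move=> w0 sw cw c0 n0; have us := div (star_neq0 c0).
have c1 a : GRing.comm 1 a by exact: commr_sym (commr1 a).
case: b sw => sw.
  by rewrite [RHS]mul1r star_quot ?star1 //; exact: commr1.
rewrite star_quotV ?star1 //; try exact: commr1.
by rewrite [RHS]mulrA mulrDr mulr1 [star c * (_ * w)]mulrA mulrV // !mul1r.
Qed.

(** * Free symmetric pairs built from [x] and [y] with [y x = q x y] *)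

Section Core.
Variables (x y q : D) (b_x b_y : bool).
Hypotheses (Nx : N x) (Ny : N y) (x0 : x != 0) (y0 : y != 0) (q0 : q != 0).
Hypothesis qN : forall m, (0 < m)%N -> q ^+ m != 1.
Hypotheses (yx : y * x = q * x * y) (qx : GRing.comm q x) (qy : GRing.comm q y).
Hypotheses (sx : star x = if b_x then x else x^-1) (sy : star y = if b_y then y else y^-1).

Let q1 : q != 1. Proof. exact: (qN (m := 1)). Qed.

Let xy : x * y = q^-1 * y * x.
Proof. by rewrite -mulrA yx !mulrA mulVr ?mul1r // div. Qed.

(** Apply [star] to [y * x = x * y * q]: the products are reversed, which inverts the commutator,
    and inverting exactly one of [x] and [y] inverts it once more. *)
Lemma starq : star q = if b_x == b_y then q^-1 else q.
Proof.
have ux := div x0; have uy := div y0; have uq := div q0.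
have yx' : y * x = x * y * q by rewrite yx qx -mulrA qy mulrA.
have E : star x * star y = star y * star x * star q.
  by rewrite -starM yx !starM !mulrA.
have us : star y * star x \is a GRing.unit by rewrite unitrMl ?div // star_neq0.
apply: (mulrI us); rewrite -E sx sy.
case: b_x b_y => [] [] /=.
- by rewrite yx' mulrK.
- rewrite -{1}(mulKr uy x) yx' -!mulrA; congr (_ * (_ * _)).
  by rewrite mulrA -qy mulrK.
- rewrite -{1}(mulrK ux y) yx' -!mulrA mulKr //; congr (_ * _).
  exact: commrV.
- have uxy : x * y \is a GRing.unit by rewrite unitrMl.
  by rewrite -!invrM //; congr (_^-1); rewrite yx mulrA.
Qed.

Let comm1 (a : D) : GRing.comm 1 a. Proof. exact: commr_sym (commr1 a). Qed.

Let commV (a b : D) : GRing.comm a b -> GRing.comm a^-1 b.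
Proof. by move=> ab; apply: commr_sym; apply: commrV; exact: commr_sym. Qed.

Let starq_comm a : GRing.comm q a -> GRing.comm (star q) a.
Proof. by move=> qa; rewrite starq; case: ifP => // _; exact: commV. Qed.

Let affx_neq0 c : GRing.comm c y -> GRing.comm c q -> 1 + c * x != 0.
Proof. by move=> cy cq; apply: affine_neq0 yx cy cq q1. Qed.

Let affy_neq0 c : GRing.comm c x -> GRing.comm c q -> 1 + c * y != 0.
Proof.
move=> cx cq; apply: affine_neq0 xy cx _ _ => //; first exact: commrV.
by apply: contraNneq q1 => E; rewrite -[q]invrK E invr1.
Qed.

Definition free_symmetric := exists u v,
  [/\ N u, N v, star u = u, star v = v & free_pair u v].

Lemma star_norm a : star (a * star a) = a * star a.
Proof. by rewrite starM starK. Qed.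

Lemma N_norm a : N a -> N (a * star a).
Proof. by move=> Na; apply: N_mul => //; exact: N_star. Qed.

Lemma core_order_two (F : fieldType) : (2%:R : F) != 0 ->
  (forall f : {poly int}, evalz q f = 0 -> evalz (-1 : F) f = 0) -> free_symmetric.
Proof.
move=> F2 compat.
have zm : (-1 : F) ^+ 2 = 1 by rewrite sqrrN expr1n.
have sq : @scal_pair D q F (-1) 1 q (-1) by exact: scal_pair_q.
have sqV : @scal_pair D q F (-1) 1 q^-1 (-1).
  by have := scal_pair_qV 'X div q0 yx qx qy zm; rewrite invrN1.
have s1 : @scal_pair D q F (-1) 1 1 1 by exact: scal_pair1.
have ssq : @scal_pair D q F (-1) 1 (star q) (-1) by rewrite starq; case: ifP.
have ssqV : @scal_pair D q F (-1) 1 (star q)^-1 (-1) by rewrite starq; case: ifP => _; rewrite ?invrK.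
pose nx := (1 + q * x) * (1 + 1 * x)^-1.
pose ny := (1 + q^-1 * y) * (1 + 1 * y)^-1.
have Nnx : N nx by have := N_quot y0 Ny yx (comm1 y) (affx_neq0 (comm1 _) (comm1 _)); rewrite mul1r.
have Nny : N ny by have := N_quot x0 Nx xy (comm1 x) (affy_neq0 (comm1 _) (comm1 _)); rewrite mul1r.
have sq0 := star_neq0 q0; have usq := div sq0.
exists (nx * star nx), (ny * star ny); split; try exact: N_norm; try exact: star_norm.
have Ex := star_mobius x0 sx (starq_comm qx) q0 (affx_neq0 (comm1 _) (comm1 _)).
have qVy : GRing.comm (star q^-1) y.
  by rewrite starV; apply: commV; exact: starq_comm.
have Ey := star_mobius y0 sy qVy (inv_neq0 q0) (affy_neq0 (comm1 _) (comm1 _)).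
rewrite {1 2}/nx {1 2}/ny Ex Ey starV.
(* The middle scalar is 1 when the generator is fixed, and [star q] or its inverse otherwise; it
   specializes to a sign, which is its own inverse. *)
pose sgn (b : bool) : F := if b then 1 else -1.
have sgn0 b : sgn b != 0 by case: b; rewrite /sgn ?oppr_eq0 oner_neq0.
have sgnV b : (sgn b)^-1 = sgn b by case: b; rewrite /sgn ?invr1 ?invrN1.
have sc_if (b : bool) (r : D) : @scal_pair D q F (-1) 1 r (-1) -> @scal_pair D q F (-1) 1 (if b then 1 else r) (sgn b).
  move=> r1; case: b; [exact: s1|exact: r1].
have if_inv (b : bool) (r r' : D) : r * r' = 1 -> (if b then 1 else r) * (if b then 1 else r') = 1.
  by case: b; rewrite ?mulr1.
have ifs (b : bool) (r r' : D) : @scal_pair D q F (-1) 1 r (-1) -> @scal_pair D q F (-1) 1 r' (-1) ->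
   @scal_pair D q F (-1) 1 (if b then r else r') (-1).
  by move=> r1 r2; case: b; [exact: r1|exact: r2].
have e1 : star q * (star q)^-1 = 1 by exact: divrr.
have e2 : (star q)^-1 * star q = 1 by exact: mulVr.
have k1 := sc_if b_x _ ssq; have k2 := sc_if b_x _ ssqV.
have l1 := sc_if b_y _ ssqV; have l2 := sc_if b_y _ ssq.
rewrite -[X in @scal_pair _ _ _ _ _ _ X]sgnV in k2; rewrite -[X in @scal_pair _ _ _ _ _ _ X]sgnV in l2.
have h2 := ifs b_x _ _ ssq ssqV; have h4 := ifs b_y _ _ ssqV ssq.
have E1 := if_inv b_x _ _ e1; have E2 := if_inv b_x _ _ e2.
have E3 := if_inv b_y _ _ e2; have E4 := if_inv b_y _ _ e1.
have := free_order_two div x0 y0 q0 qN yx qx qy compat F2 k1 k2 E1 E2 (sgn0 b_x) sq h2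
  l1 l2 E3 E4 (sgn0 b_y) sqV h4.
by rewrite /norm_mobius invrK.
Qed.

(** Since [star g = g^-1], conjugation by [g] preserves symmetric elements. *)
Lemma free_symmetric_conj n w g : N n -> star n = w -> g != 0 -> star g = g^-1 ->
  free_pair (n * w) (g^-1 * (n * w) * g) -> free_symmetric.
Proof.
move=> Nn nw g0 sg fp; exists (n * w), (g^-1 * (n * w) * g); split=> //.
- by rewrite -nw; exact: N_norm.
- by apply: N_conj => //; rewrite -nw; exact: N_norm.
- by rewrite -nw star_norm.
- by rewrite -nw starM [star (g^-1 * _)]starM starV sg invrK star_norm mulrA.
Qed.

Section Odd.
Variables (F : closedFieldType) (z : F) (m : nat).
Hypotheses (prim : m.+1.-primitive_root z) (om : odd m.+1) (m1 : (0 < m)%N).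
Hypothesis F2 : (2%:R : F) != 0.
Hypothesis compat : forall f : {poly int}, evalz q f = 0 -> evalz z f = 0.

Let zm : z ^+ m.+1 = 1. Proof. exact: prim_expr_order prim. Qed.

(** As [y] is inverted, [star] swaps coefficients, and [g = (1 + 2 y) (2 + y)^-1] satisfies
    [star g = g^-1]. Nondegeneracy requires 4 to differ from 1, hence the condition on 3. *)
Lemma core_odd_inverted : b_y = false -> (3%:R : F) != 0 -> free_symmetric.
Proof.
move=> byF F3.
have two : (2%:R : F) != 0 by [].
have one0 : (1 : F) != 0 by exact: oner_neq0.
have [s [s0 h1 h2 h3 h4]] := generic_shift m F2 F2 one0.
have s1 : @scal_pair D q F z m 1 1 by exact: scal_pair1.
have s2 : @scal_pair D q F z m 2%:R 2%:R by exact: scal_pair_nat.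
have sq : @scal_pair D q F z m q z by exact: scal_pair_q.
have sqV : @scal_pair D q F z m q^-1 z^-1 by exact: (scal_pair_qV s%:P div q0 yx qx qy zm).
have z0 : z != 0 by rewrite (prim_root_eq0 prim).
have uq := div q0.
have l1 : 1 + 1 * x != 0 by exact: affx_neq0 (comm1 _) (comm1 _).
have l2 := liny_neq0 s%:P div x0 y0 q0 qN yx qx qy zm compat s2 s1 F2.
have l3 := liny_neq0 s%:P div x0 y0 q0 qN yx qx qy zm compat s1 s2 one0.
(* With [n = (1 + q x) (1 + x)^-1], whether [x] is fixed or inverted, [star n = k n]; so both
   factors of [u] degenerate at the same point. *)
pose k := if b_x then 1 else q^-1.
pose k2 : F := if b_x then 1 else z^-1.
have k20 : k2 != 0 by rewrite /k2; case: ifP; rewrite ?invr_eq0.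
have Tk : model_transfer x y q z s%:P k (cst_mx m k2) 1 (cst_mx m k2^-1) 1.
  apply: (model_transfer_scal s%:P div q0 yx qx qy zm (e' := if b_x then 1 else q)).
  - by rewrite /k /k2; case: b_x; [exact: s1|exact: sqV].
  - rewrite /k2; case: b_x; first by rewrite invr1; exact: s1.
    by rewrite invrK; exact: sq.
  - by rewrite /k; case: b_x; [exact: mulr1|exact: mulVr].
  - by rewrite /k; case: b_x; [exact: mulr1|exact: divrr].
  - exact: divff.
have Tw := transfer2M div Tk (model_transfer_quotx s%:P div x0 y0 q0 qN yx qx qy zm compat s1 sq one0 s1 s1 one0).
have c2V (a : D) : GRing.comm 2%:R a by exact: commr_sym (commr_nat a 2).
apply: (@free_symmetric_conj ((1 + (1 * q) * x) * (1 + 1 * x)^-1)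
  (k * ((1 + q * x) * (1 + 1 * x)^-1)) ((1 + 2%:R * y) * (2%:R + 1 * y)^-1)).
- exact: N_quot y0 Ny yx (comm1 y) l1.
- rewrite mul1r (star_mobius x0 sx (starq_comm qx) q0 l1) /k starq byF.
  by case: b_x; rewrite /= ?invrK.
- by apply: mul_neq0 => //; exact: inv_neq0.
- have syV : star y = y^-1 by rewrite sy byF.
  rewrite (star_quotV y0 syV) ?starn ?star1 //; try exact: commr1.
  by rewrite invrM ?unitrV ?div // invrK.
have evk t k3 (M : 'M[{poly F}]_m.+1) g : map_mx (ev t) M = diagf g ->
    map_mx (ev t) (cst_mx m k3 * M) = diagf (fun i => k3 * g i).
  by move=> ME; rewrite rmorphM /= -/(ev t) ME map_alg /= /horner_eval hornerC diagfA diagfM.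
have evk' t k3 (M : 'M[{poly F}]_m.+1) g : map_mx (ev t) M = diagf g ->
    map_mx (ev t) (M * cst_mx m k3) = diagf (fun i => g i * k3).
  by move=> ME; rewrite rmorphM /= -/(ev t) ME map_alg /= /horner_eval hornerC diagfA diagfM.
have E1 := evk (- 1^-1) k2 _ _ (ev_quotx z m (- 1^-1) 1 z 1 1).
have E2 := evk' (- 1^-1) k2^-1 _ _ (ev_quotx z m (- 1^-1) 1 1 1 z).
have n0 : (m.+1%:R : F) != 0 by exact: prim_root_natf_neq0 prim.
have z1 : z != 1.
  by have := prim_order_dvd prim 1; rewrite expr1 dvdn1 => <-; rewrite eqSS -lt0n.
have zmV : z * z ^+ m = 1 by rewrite -exprS.
have ones : \sum_(l < m.+1) 1 ^+ (m - l) * 1 ^+ l = m.+1%:R :> F.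
  by under eq_bigr do rewrite !expr1n mulr1; rewrite sumr_const card_ord.
have f0 : k2 * ((1 + z * (- 1^-1 * z ^+ (ord0 : 'I_m.+1))) *
    \sum_(l < m.+1) 1 ^+ (m - l) * (- 1 * (- 1^-1 * z ^+ (ord0 : 'I_m.+1))) ^+ l) != 0.
  by rewrite expr0 invr1 !mulr1 mulrNN mulr1 mulrN1 ones !mulf_neq0 // subr_eq0 eq_sym.
have f0' : (1 + 1 * (- 1^-1 * z ^+ (ord_max : 'I_m.+1))) *
    (\sum_(l < m.+1) 1 ^+ (m - l) * (- z * (- 1^-1 * z ^+ (ord_max : 'I_m.+1))) ^+ l) * k2^-1 != 0.
  rewrite invr1 mul1r !mulN1r mulrNN zmV ones !mulf_neq0 ?invr_eq0 // subr_eq0 eq_sym.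
  by apply: contraNneq z1 => zm1; rewrite -zmV zm1 mulr1.
have ab : (2%:R : F) * 2%:R != 1.
  by rewrite -natrM -subr_eq0 -(natrB _ (isT : (1 <= 4)%N)).
exact: (free_conj_pole div x0 y0 q0 qN yx qx qy prim m1 compat s1 one0 Tw E1 f0 E2 f0'
  s2 s2 s1 s0 F2 F2 one0 ab h1 h2 h3 h4).
Qed.

(* Here the involution inverts [q] and maps the pole at [1 + c x] to the one at
   [1 + star c x]; the choice [c = q - q^-1], [star c = - c], keeps them in distinct
   orbits of [z], as [-1] is not a power of [z]. *)
Lemma core_odd_symmetric : b_x = true -> b_y = true -> free_symmetric.
Proof.
move=> bxT byT.
have one0 : (1 : F) != 0 by exact: oner_neq0.
have z0 : z != 0 by rewrite (prim_root_eq0 prim).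
have zV0 : z^-1 != 0 by rewrite invr_eq0.
(* The parameters are the images of the coefficients of [g = (1 + q y) (1 + q^-1 y)^-1]. As [star]
   fixes [y] and exchanges [q] with [q^-1], it inverts [g]. *)
have [s [s0 h1 h2 h3 h4]] := generic_shift m z0 one0 zV0.
have s1 : @scal_pair D q F z m 1 1 by exact: scal_pair1.
have sq : @scal_pair D q F z m q z by exact: scal_pair_q.
have sqV : @scal_pair D q F z m q^-1 z^-1 by exact: (scal_pair_qV s%:P div q0 yx qx qy zm).
have sV : star q = q^-1 by rewrite starq bxT byT.
have sVV : star q^-1 = q by rewrite starV sV invrK.
have sxT : star x = x by rewrite sx bxT.
have syT : star y = y by rewrite sy byT.
have uq := div q0.
pose c := q - q^-1; pose d := q^-1 - q.
have scE : star c = d by rewrite /c starD starNr sV sVV.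
have cc : @scal_pair D q F z m c (z - z^-1) by exact: scal_pairB.
have dd : @scal_pair D q F z m d (z^-1 - z) by exact: scal_pairB.
have qd : @scal_pair D q F z m (q^-1 * d) (z^-1 * (z^-1 - z)).
  exact: (scal_pairM s%:P div q0 yx qx qy zm sqV dd).
have z2 : z ^+ 2 != 1.
  rewrite -(prim_order_dvd prim); apply/negP => /(dvdn_leq (isT : (0 < 2)%N)).
  by move: om m1; case: (m) => [|[|k]].
have c20 : z - z^-1 != 0.
  rewrite subr_eq0; apply: contraNneq z2 => E.
  by rewrite expr2 {2}E divff.
have comm_c a : GRing.comm q a -> GRing.comm c a.
  move=> qa; apply: commr_sym; apply: commrB; first exact: commr_sym.
  by apply: commrV; exact: commr_sym.
have comm_d a : GRing.comm q a -> GRing.comm d a.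
  move=> qa; apply: commr_sym; apply: commrB; last exact: commr_sym.
  by apply: commrV; exact: commr_sym.
have comm_qd a : GRing.comm q a -> GRing.comm (q^-1 * d) a.
  move=> qa; apply: commr_sym; apply: commrM; last by apply: commr_sym; exact: comm_d.
  by apply: commrV; exact: commr_sym.
have qq : GRing.comm q q by exact: commr_refl.
have Tw := model_transfer_quotx s%:P div x0 y0 q0 qN yx qx qy zm compat s1 qd one0 s1 dd one0.
have l1 : 1 + c * x != 0 by apply: affx_neq0; exact: comm_c.
have lq := affy_neq0 qx qq.
have qVq : GRing.comm q^-1 q by exact: commV.
have lqV := affy_neq0 (commV qx) qVq.
apply: (@free_symmetric_conj ((1 + (c * q) * x) * (1 + c * x)^-1)
  ((1 + (q^-1 * d) * x) * (1 + d * x)^-1) ((1 + q * y) * (1 + q^-1 * y)^-1)).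
- exact: N_quot y0 Ny yx (comm_c _ qy) l1.
- have scq' : star (c * q) = q^-1 * d by rewrite starM sV scE.
  rewrite star_quot ?scq' ?scE //; [exact: comm_qd|exact: comm_d|].
  apply: comm_qd; apply: commr_sym; exact: comm_d.
- by apply: mul_neq0 => //; exact: inv_neq0.
- rewrite star_quot ?sV ?sVV //; try exact: commV.
  by rewrite invrM ?unitrV ?div // invrK.
have ct : (z - z^-1) * (- (z - z^-1)^-1) = -1 by rewrite mulrN divff.
have dt : (z^-1 - z) * (- (z - z^-1)^-1) = 1 by rewrite -[z^-1 - z]opprB mulNr ct opprK.
have zmV : z^-1 = z ^+ m by apply: (mulfI z0); rewrite divff // -exprS.
have odd1 : (-1 : F) ^+ m.+1 = -1 by rewrite -signr_odd om expr1.
(* If [z ^+ k] were -1, raising to the odd power [m.+1] would give [1 = -1]. *)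
have zN1 k : 1 + z ^+ k != 0.
  apply/eqP => E; have zk : z ^+ k = -1 by apply/eqP; rewrite -addr_eq0 addrC E.
  have := congr1 (fun r => r ^+ m.+1) zk.
  rewrite exprAC zm expr1n odd1 => /eqP.
  by rewrite -addr_eq0 -[1 + 1]/(2%:R) (negPf F2).
set t := - (z - z^-1)^-1 in ct dt *.
have E1 := ev_quotx z m t 1 (z^-1 * (z^-1 - z)) 1 (z^-1 - z).
have E2 := ev_quotx z m t 1 (z^-1 - z) 1 (z^-1 * (z^-1 - z)).
(* The numerator is [1 + z ^+ m] in both entries, and the ratios of the geometric sums have
   [m.+1]-th power -1, so [sum_pow_neg] applies. *)
have f0 : (1 + z^-1 * (z^-1 - z) * (t * z ^+ (ord0 : 'I_m.+1))) *
  \sum_(l < m.+1) 1 ^+ (m - l) * (- (z^-1 - z) * (t * z ^+ (ord0 : 'I_m.+1))) ^+ l != 0.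
  rewrite expr0 mulr1 mulNr -mulrA dt mulr1 zmV mulf_neq0 //.
  under eq_bigr do rewrite expr1n mul1r.
  exact: sum_pow_neg.
have f0' : (1 + (z^-1 - z) * (t * z ^+ (ord_max : 'I_m.+1))) *
  \sum_(l < m.+1) 1 ^+ (m - l) * (- (z^-1 * (z^-1 - z)) * (t * z ^+ (ord_max : 'I_m.+1))) ^+ l != 0.
  rewrite [(z^-1 - z) * (t * _)]mulrA dt mul1r mulf_neq0 //.
  under eq_bigr do rewrite expr1n mul1r mulNr [z^-1 * (z^-1 - z)]mulrC mulrACA dt mul1r.
  apply: sum_pow_neg => //.
  by rewrite exprNn odd1 exprMn exprVn zm invr1 mul1r exprAC zm expr1n mulr1.
have ab : z * 1 != z^-1 by rewrite mulr1 -subr_eq0.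
exact: (free_conj_pole div x0 y0 q0 qN yx qx qy prim m1 compat cc c20 Tw E1 f0 E2 f0'
  sq s1 sqV s0 z0 one0 zV0 ab h1 h2 h3 h4).
Qed.

End Odd.

End Core.
End Involution.

(** * Choice of the specialization and of the roles of [x] and [y] *)

Section QuantumPair.
Variables (D : unitRingType) (star : D -> D) (N : D -> Prop).
Hypothesis div : division_ring D.
Hypothesis D2 : (2%:R : D) != 0.
Hypothesis inv : k_involution star.
Hypotheses (norN : normal_in_units N) (starN : star_stable star N).

Lemma N_exp x n : N x -> N (x ^+ n).
Proof.
move=> Nx; elim: n => [|n IH]; first by case: norN => [[]].
by rewrite exprS; exact: N_mul.
Qed.

Lemma star_exp x n : star (x ^+ n) = star x ^+ n.
Proof.
elim: n => [|n IH]; first by rewrite !expr0 (star1 inv).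
by case: inv => _ _ starM _; rewrite exprS starM IH exprSr.
Qed.

(** The condition on signs leaves out [x] inverted with [y] fixed. For odd [n] the other cases are
    those of [core_odd_symmetric] and [core_odd_inverted]. For [n = 2 k], passing to [x ^+ k]
    replaces [q] by [q ^+ k], which specializes to -1. *)
Lemma quantum_pair_free_aux (x y q : D) (b_x b_y : bool) :
  b_x || ~~ b_y ->
  N x -> N y -> x != 0 -> y != 0 -> q != 0 ->
  (forall m, (0 < m)%N -> q ^+ m != 1) ->
  y * x = q * x * y -> GRing.comm q x -> GRing.comm q y ->
  star x = (if b_x then x else x^-1) -> star y = (if b_y then y else y^-1) ->
  free_symmetric star N.
Proof.
move=> bb Nx Ny x0 y0 q0 qN yx qx qy sx sy.
have [F [z [n [n1 prim F2 F3 compat]]]] := specialization div D2 q0 qN.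
case: (boolP (odd n)) => [on|en].
  case: n n1 prim F3 on => // m m1 prim F3 on.
  case: b_y b_x bb sx sy => [] [] //= _ sx sy.
  - exact: (core_odd_symmetric div inv norN starN (b_x := true) (b_y := true) Ny x0 y0 q0 qN yx qx qy sx sy prim on m1 F2 compat erefl erefl).
  - exact: (core_odd_inverted div inv norN starN (b_x := true) (b_y := false) Ny x0 y0 q0 qN yx qx qy sx sy prim m1 F2 compat erefl (F3 on)).
  - exact: (core_odd_inverted div inv norN starN (b_x := false) (b_y := false) Ny x0 y0 q0 qN yx qx qy sx sy prim m1 F2 compat erefl (F3 on)).
pose k := n./2.
have nk : n = (k * 2)%N by rewrite muln2 -[LHS]odd_double_half (negPf en).
have k0 : (0 < k)%N by rewrite lt0n; apply: contraTneq n1 => k0; rewrite nk k0.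
have uq := div q0.
have rel := skew_commX (And5 yx (divrr uq) (mulVr uq) qx qy) k.
have zk : z ^+ k = -1.
  have /eqP : z ^+ k ^+ 2 = 1 by rewrite -exprM -nk prim_expr_order.
  rewrite sqrf_eq1 => /orP[|/eqP //]; rewrite -(prim_order_dvd prim).
  by move=> /(dvdn_leq k0); rewrite nk leqNgt ltn_Pmulr.
have expn0 (a : D) : a != 0 -> a ^+ k != 0.
  move=> /div ua; apply/eqP => E; have := unitrX k ua; by rewrite E unitr0.
apply: (core_order_two div inv norN starN (N_exp k Nx) Ny (expn0 _ x0) y0 (expn0 _ q0) _ rel _ _ (b_x := b_x) (b_y := b_y) _ sy F2).
- by move=> m m0; rewrite -exprM; apply: qN; rewrite muln_gt0 k0.
- by apply: commrX; apply: commr_sym; exact: commrX (commr_sym qx).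
- by apply: commr_sym; apply: commrX; exact: commr_sym.
- by rewrite star_exp sx; case: b_x {bb sx} => //; rewrite exprVn.
- by move=> f; rewrite -evalz_compX => /compat; rewrite evalz_compX zk.
Qed.

(** The remaining combination of signs becomes an allowed one after exchanging [x] and [y], which
    inverts [q]. *)
Lemma quantum_pair_free (x y q : D) (b_x b_y : bool) :
  N x -> N y -> x != 0 -> y != 0 -> q != 0 ->
  (forall m, (0 < m)%N -> q ^+ m != 1) ->
  y * x = q * x * y -> GRing.comm q x -> GRing.comm q y ->
  star x = (if b_x then x else x^-1) -> star y = (if b_y then y else y^-1) ->
  free_symmetric star N.
Proof.
move=> Nx Ny x0 y0 q0 qN yx qx qy sx sy.
case: (boolP (b_x || ~~ b_y)) => bb.
  exact: quantum_pair_free_aux bb Nx Ny x0 y0 q0 qN yx qx qy sx sy.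
have uq := div q0.
have commV a : GRing.comm q a -> GRing.comm q^-1 a.
  by move=> h; apply: commr_sym; apply: commrV; exact: commr_sym.
apply: (quantum_pair_free_aux (x := y) (y := x) (q := q^-1) (b_x := b_y) (b_y := b_x)) => //.
- by move: bb; rewrite negb_or negbK => /andP[_ ->].
- exact: inv_neq0.
- move=> m m0; rewrite exprVn; apply: contra (qN m m0) => /eqP E.
  by rewrite -[_ ^+ _]invrK E invr1.
- by rewrite -mulrA yx !mulrA mulVr // mul1r.
- exact: commV.
- exact: commV.
Qed.

End QuantumPair.

(** * Pairs of elements in nilpotent groups with involution *)

Section Groups.
Variables (D : unitRingType).
Hypothesis div : division_ring D.
Implicit Types (a b c h g : D) (H : D -> Prop).

Lemma commE a h : a != 0 -> h != 0 -> a * h = h * a * comm a h.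
Proof.
move=> a0 h0; have ua := div a0; have uh := div h0.
by rewrite /comm !mulrA -[h * a * a^-1]mulrA divrr // mulr1 divrr // mul1r.
Qed.

Lemma comm_uniq a h c : a != 0 -> h != 0 -> a * h = h * a * c -> comm a h = c.
Proof.
move=> a0 h0 E; apply: (mulrI (div (mul_neq0 div h0 a0))).
by rewrite -commE.
Qed.

Lemma comm_eq1 a h : a != 0 -> h != 0 -> a * h = h * a -> comm a h = 1.
Proof. by move=> a0 h0 E; apply: comm_uniq => //; rewrite mulr1. Qed.

Lemma lcs_subgroup H n : is_subgroup H -> is_subgroup (lcs H n) /\ subset_of (lcs H n) H.
Proof.
move=> sH; elim: n => [|n [sL LH]]; first by split=> [|a].
have [h1 hn hM hV] := sH.
have sub : subset_of (lcs H n.+1) H.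
  move=> a; elim=> [//|_ [x [y [/LH Lx [Hy ->]]]]|b c _ Hb _ Hc|b _ Hb].
  - by rewrite /comm; do 3 apply: (hM) => //; exact: hV.
  - exact: hM.
  - exact: hV.
split=> //; split.
- exact: gen1.
- by move=> a /sub /hn.
- exact: genM.
- exact: genV.
Qed.

Lemma lcs_mono H H' n : subset_of H H' -> subset_of (lcs H n) (lcs H' n).
Proof.
move=> HH; elim: n => //= n IH a; elim.
- exact: gen1.
- by move=> b [x [y [Lx [Hy ->]]]]; apply: genA; exists x, y; split; [exact: IH|split=> //; exact: HH].
- by move=> b c _ gb _ gc; exact: genM.
- by move=> b _ gb; exact: genV.
Qed.

(** Take the last nontrivial term [lcs H k.+1]. It exists because [lcs H 0] is [H] itself, so that
    [lcs H 1] is nontrivial for a nonabelian [H]. *)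
Lemma nilpotent_last H : is_subgroup H -> nilpotent H -> ~ abelian H ->
  exists k, (forall x, lcs H k.+2 x -> x = 1) /\
    exists a h, [/\ lcs H k a, H h & comm a h != 1].
Proof.
move=> sH [n Hn] nab; have [h1 hn hM hV] := sH.
have nab1 : ~ (forall x, lcs H 1 x -> x = 1).
  move=> L1; apply: nab => x y Hx Hy.
  rewrite (commE (hn _ Hx) (hn _ Hy)) (L1 (comm x y)) ?mulr1 //.
  by apply: genA; exists x, y.
have [k [kT kN]] : exists k, (forall x, lcs H k.+2 x -> x = 1) /\ ~ (forall x, lcs H k.+1 x -> x = 1).
  case: n Hn => [|n] Hn.
    by case: nab => x y /Hn -> /Hn ->.
  elim: n Hn => [|n IH] Hn; first by case: nab1.
  case: (classic (forall x, lcs H n.+1 x -> x = 1)) => [/IH //|nt].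
  by exists n.
exists k; split=> //; apply: NNPP => no; apply: kN => x /=.
elim=> // [y [a [h [La [Hh ->]]]]|a b _ -> _ ->|a _ ->]; rewrite ?mulr1 ?invr1 //.
by apply/eqP/negPn/negP => ah; apply: no; exists a, h.
Qed.

Section Star.
Variable star : D -> D.
Hypothesis inv : k_involution star.
Let starM a b : star (a * b) = star b * star a. Proof. by case: inv. Qed.
Let starK a : star (star a) = a. Proof. by case: inv. Qed.
Let stV := starV div inv.

Variable H : D -> Prop.
Hypothesis sH : is_subgroup H.
Hypothesis starH : forall a, H a -> H (star a).

Let Hn a : H a -> a != 0. Proof. by case: sH => _ h _ _; exact: h. Qed.
Let HM a b : H a -> H b -> H (a * b). Proof. by case: sH => _ _ h _; exact: h. Qed.
Let HV a : H a -> H a^-1. Proof. by case: sH => _ _ _ h; exact: h. Qed.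

(** The involution carries the commutator of [x] and [y] to the inverse of the commutator of
    [(star x)^-1] and [(star y)^-1]. *)
Lemma lcs_star n a : lcs H n a -> lcs H n (star a).
Proof.
elim: n a => [|n IH] a /=; first exact: starH.
have [[_ _ _ LV] LH] := lcs_subgroup n sH.
elim=> [|_ [x [y [Lx [Hy ->]]]]|b c _ gb _ gc|b _ gb].
- by rewrite (star1 inv); exact: gen1.
- have ux := div (Hn (LH _ Lx)); have uy := div (Hn Hy).
  have usx := div (star_neq0 inv (Hn (LH _ Lx))); have usy := div (star_neq0 inv (Hn Hy)).
  have -> : star (comm x y) = (comm (star x)^-1 (star y)^-1)^-1.
    rewrite /comm !starM !stV !invrK !invrM ?unitrMl ?unitrV // !invrK.
    by rewrite !mulrA.
  apply: genV; apply: genA; exists (star x)^-1, (star y)^-1; split; last by split=> //; apply/HV/starH.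
  by apply: LV; exact: IH.
- by rewrite starM; exact: genM.
- by rewrite stV; exact: genV.
Qed.

Variables (k : nat).
Hypothesis kT : forall x, lcs H k.+2 x -> x = 1.
Hypothesis tf : torsion_free H.

Let K := lcs H k.
Let sK : is_subgroup K. Proof. by case: (lcs_subgroup k sH). Qed.
Let KH a : K a -> H a. Proof. by case: (lcs_subgroup k sH) => _; exact. Qed.

Let B_H a h : K a -> H h -> H (comm a h).
Proof. by move=> /KH Ka Hh; rewrite /comm; do 3 apply: (HM) => //; exact: HV. Qed.

Lemma comm_central a h g : K a -> H h -> H g -> GRing.comm (comm a h) g.
Proof.
move=> Ka Hh Hg; have Hc := B_H Ka Hh.
rewrite /GRing.comm (commE (Hn Hc) (Hn Hg)) (kT (x := comm (comm a h) g)) ?mulr1 //.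
by apply: genA; exists (comm a h), g; split=> //; apply: genA; exists a, h.
Qed.

(** Commutators of [K] with [H] are central in [H], which makes [comm] multiplicative in both
    arguments; the next three lemmas record the other rules. *)
Lemma comm_mull a b h : K a -> K b -> H h -> comm (a * b) h = comm a h * comm b h.
Proof.
move=> Ka Kb Hh; have a0 := Hn (KH Ka); have b0 := Hn (KH Kb); have h0 := Hn Hh.
apply: comm_uniq => //; first exact: mul_neq0.
move: (comm a h) (comm b h) (commE a0 h0) (commE b0 h0) (comm_central Ka Hh (KH Kb)).
by move=> c d ah bh cb; rewrite -mulrA bh !mulrA ah -[h * a * c * b]mulrA cb !mulrA.
Qed.

Lemma comm_mulr a h g : K a -> H h -> H g -> comm a (h * g) = comm a h * comm a g.
Proof.
move=> Ka Hh Hg; have a0 := Hn (KH Ka); have g0 := Hn Hg; have h0 := Hn Hh.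
apply: comm_uniq => //; first exact: mul_neq0.
move: (comm a h) (comm a g) (commE a0 h0) (commE a0 g0) (comm_central Ka Hh Hg)
  (comm_central Ka Hh (B_H Ka Hg)).
move=> c d ah ag cg cd; rewrite mulrA ah -[_ * c * g]mulrA cg -!mulrA cd.
by rewrite [a * (g * _)]mulrA ag !mulrA.
Qed.

Lemma comm_invl a h : K a -> H h -> comm a^-1 h = (comm a h)^-1.
Proof.
move=> Ka Hh; have KV : K a^-1 by case: sK => _ _ _; exact.
have uc := div (Hn (B_H Ka Hh)).
apply: (mulrI uc); rewrite mulrV // -(comm_mull Ka KV Hh) mulrV ?div ?(Hn (KH Ka)) //.
by apply: comm_eq1; rewrite ?oner_neq0 ?(Hn Hh) // mul1r mulr1.
Qed.

Lemma comm_invr a h : K a -> H h -> comm a h^-1 = (comm a h)^-1.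
Proof.
move=> Ka Hh; have uc := div (Hn (B_H Ka Hh)).
apply: (mulrI uc); rewrite mulrV // -(comm_mulr Ka Hh (HV Hh)) mulrV ?div ?(Hn Hh) //.
by apply: comm_eq1; rewrite ?oner_neq0 ?(Hn (KH Ka)) // mul1r mulr1.
Qed.

Let sq_neq1 c : H c -> c != 1 -> c * c != 1.
Proof.
by move=> Hc; apply: contra => /eqP cc; apply/eqP; apply: (tf Hc (isT : (0 < 2)%N)); rewrite expr2.
Qed.

(** Either some [b * star b] with [b] in [K] fails to commute with an element of [H], or all of them
    are central in [H]. In the second case [a] commutes with [star a], so [a * (star a)^-1] is
    inverted by [star], and its commutator with [h] is the square of [comm a h], nontrivial as [H]
    is torsion-free. *)
Lemma symmetric_left a h : K a -> H h -> comm a h != 1 ->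
  exists x (b_x : bool), [/\ K x, star x = if b_x then x else x^-1 & exists2 g, H g & comm x g != 1].
Proof.
move=> Ka Hh ah; have [_ _ KM KV] := sK.
case: (classic (exists b g, [/\ K b, H g & comm (b * star b) g != 1])) => [[b [g [Kb Hg bg]]]|no].
  exists (b * star b), true; split; [|by rewrite starM starK|by exists g].
  by apply: KM => //; exact: lcs_star.
have cen b g : K b -> H g -> comm (b * star b) g = 1.
  by move=> Kb Hg; apply/eqP/negPn/negP => bg; apply: no; exists b, g.
have Ks : K (star a) by exact: lcs_star.
have a0 := Hn (KH Ka); have s0 := Hn (KH Ks).
exists (a * (star a)^-1), false; split.
- by apply: KM => //; exact: KV.
- have as_ : GRing.comm a (star a).
    have := commE (mul_neq0 div a0 s0) a0; rewrite (cen a a Ka (KH Ka)) mulr1 => E.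
    by apply: (mulrI (div a0)); rewrite -E !mulrA.
  rewrite starM stV starK invrM ?unitrV ?div // invrK.
  by apply: commr_sym; apply: commrV; exact: commr_sym.
- exists h => //; rewrite (comm_mull Ka (KV _ Ks) Hh) (comm_invl Ks Hh).
  have := cen a h Ka Hh; rewrite (comm_mull Ka Ks Hh) => E.
  have us := div (Hn (B_H Ks Hh)).
  have -> : (comm (star a) h)^-1 = comm a h.
    by rewrite -[RHS]mulr1 -[X in _ * X](divrr us) mulrA E mul1r.
  by apply: sq_neq1 => //; exact: B_H.
Qed.

(* Replacing [g] by [g (star g)^-1] pushes [g^-1 (star g)^-1] one step down the lower central series. *)
Lemma antisymmetric_right x h i : K x -> H h -> comm x h != 1 ->
  (forall g, H g -> comm x (g * star g) = 1) ->
  exists g, [/\ H g, comm x g != 1 & lcs H i (g^-1 * (star g)^-1)].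
Proof.
move=> Kx Hh xh cen; elim: i => [|i [g [Hg xg Lg]]].
  by exists h; split=> //=; apply: HM; apply: HV => //; exact: starH.
have Hs := starH Hg; have g0 := Hn Hg; have s0 := Hn Hs.
have ug := div g0; have us := div s0.
exists (g * (star g)^-1); split.
- by apply: HM => //; exact: HV.
- have := cen g Hg; rewrite (comm_mulr Kx Hg Hs) (comm_mulr Kx Hg (HV Hs)) (comm_invr Kx Hs) => E.
  have uc := div (Hn (B_H Kx Hs)).
  have -> : (comm x (star g))^-1 = comm x g.
    by rewrite -[RHS]mulr1 -[X in _ * X](divrr uc) mulrA E mul1r.
  by apply: sq_neq1 => //; exact: B_H.
(* The element formed from the new [g] is the commutator of [ze] with the old one. *)
- set ze := g^-1 * (star g)^-1 in Lg.
  apply: genA; exists ze, g; split=> //; split=> //.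
  rewrite starM stV starK invrM ?unitrV // invrK invrM ?unitrV // invrK.
  rewrite /comm /ze invrM ?unitrV // !invrK -!mulrA; congr (_ * _).
  by rewrite mulVKr.
Qed.

(** If every [g * star g] commutes with [x], then [antisymmetric_right] is followed down to the
    trivial term of the lower central series, where [star g = g^-1]. *)
Lemma symmetric_right x h : K x -> H h -> comm x h != 1 ->
  exists y (b_y : bool), [/\ H y, star y = if b_y then y else y^-1 & comm x y != 1].
Proof.
move=> Kx Hh xh.
case: (classic (exists2 g, H g & comm x (g * star g) != 1)) => [[g Hg xg]|no].
  exists (g * star g), true; split=> //; last by rewrite starM starK.
  by apply: HM => //; exact: starH.
have cen g : H g -> comm x (g * star g) = 1.
  by move=> Hg; apply/eqP/negPn/negP => xg; apply: no; exists g.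
have [g [Hg xg /kT E]] := antisymmetric_right k.+2 Kx Hh xh cen.
exists g, false; split=> //; have us := div (star_neq0 inv (Hn Hg)); have ug := div (Hn Hg).
have : (star g)^-1 = g by rewrite -[LHS](mulVKr ug) E mulr1.
by move=> E'; rewrite -[star g]invrK E'.
Qed.

End Star.

Lemma heisenberg_pair star H : k_involution star -> is_subgroup H ->
  (forall a, H a -> H (star a)) -> torsion_free H -> nilpotent H -> ~ abelian H ->
  exists x y q (b_x b_y : bool), [/\ [/\ H x, H y & q != 0],
    (forall m, (0 < m)%N -> q ^+ m != 1),
    [/\ y * x = q * x * y, GRing.comm q x & GRing.comm q y],
    star x = (if b_x then x else x^-1) & star y = (if b_y then y else y^-1)].
Proof.
move=> inv sH starH tf nH nab.
have [k [kT [a [h [Ka Hh ah]]]]] := nilpotent_last sH nH nab.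
have [x [b_x [Kx sx [g Hg xg]]]] := symmetric_left inv sH starH kT tf Ka Hh ah.
have [y [b_y [Hy sy xy]]] := symmetric_right inv sH starH kT tf Kx Hg xg.
have Hx : H x by case: (lcs_subgroup k sH) => _; exact.
have [_ Hn HM HV] := sH.
have Hz : H (comm x y) by rewrite /comm; do 3 apply: (HM) => //; exact: HV.
have uz := div (Hn _ Hz).
have cz b : H b -> GRing.comm (comm x y)^-1 b.
  move=> Hb; apply: commr_sym; apply: commrV; apply: commr_sym.
  exact: (comm_central sH kT Kx Hy Hb).
(* From [x y = y x [x, y]] and centrality of the commutator follows [y x = q x y] with [q] its
   inverse. *)
exists x, y, (comm x y)^-1, b_x, b_y; split=> //.
- by split=> //; apply: (inv_neq0 div); exact: Hn.
- move=> m m0; apply: contra xy => /eqP E; apply/eqP; apply: (tf _ m Hz m0).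
  by rewrite -[_ ^+ _]invrK -exprVn E invr1.
- split; [|exact: cz..].
  by rewrite -mulrA (cz _ (HM _ _ Hx Hy)) (commE (Hn _ Hx) (Hn _ Hy)) mulrK.
Qed.

End Groups.

(** * Finite index and conclusion *)

(** Finite choice, used to pick a representative in each nonempty class of a finite partition. *)
Lemma seq_choice (T U : eqType) (P : T -> U -> Prop) (s : seq T) :
  exists s' : seq U, forall t, t \in s -> (exists u, P t u) -> exists2 u, u \in s' & P t u.
Proof.
elim: s => [|t s [s' IH]]; first by exists [::].
case: (classic (exists u, P t u)) => [[u Pu]|no].
  exists (u :: s') => t'; rewrite inE => /orP[/eqP -> _|/IH h /h [u' u's Pu']].
    by exists u; rewrite // mem_head.
  by exists u'; rewrite // inE u's orbT.
by exists s' => t'; rewrite inE => /orP[/eqP -> /no //|/IH].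
Qed.

Section StarCore.
Variables (D : unitRingType) (star : D -> D) (G H0 : D -> Prop).
Hypotheses (div : division_ring D) (inv : k_involution star).
Hypotheses (sG : is_subgroup G) (starG : star_stable star G).
Hypotheses (sH0 : is_subgroup H0) (HG : subset_of H0 G) (fi : finite_index H0 G).

Definition star_core a := H0 a /\ H0 (star a).

Lemma star_core_subgroup : is_subgroup star_core.
Proof.
have [_ _ starM _] := inv; have [h1 hn hM hV] := sH0; split.
- by split; rewrite ?(star1 inv).
- by move=> a [/hn].
- by move=> a b [Ha Hsa] [Hb Hsb]; split; rewrite ?starM; exact: hM.
- by move=> a [Ha Hsa]; split; rewrite ?(starV div inv); exact: hV.
Qed.

(** Classify [g] by the right cosets of [H0] containing [g] and [star g^-1]; the inverse compensates
    for [star] reversing products. If [g] and [u] lie in the same class, then [g * u^-1] lies in the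
    core. *)
Lemma star_core_finite_index : finite_index star_core G.
Proof.
have [_ _ starM starK] := inv; have [h1 hn hM hV] := sH0; have [_ gn gM gV] := sG.
have [s sP] := fi.
pose P (t : D * D) g := (exists2 h, H0 h & g = h * t.1) /\ (exists2 h, H0 h & star g^-1 = h * t.2).
have [s' s'P] := seq_choice P [seq (a, b) | a <- s, b <- s].
exists s' => g Gg; have Gs : G (star g^-1) by apply/starG; exists g^-1; split=> //; exact: gV.
have [t ts [h [Hh gE]]] := sP g Gg.
have [t' ts' [h' [Hh' gE']]] := sP _ Gs.
have [|u us [[k Hk uE] [k' Hk' uE']]] := s'P (t, t') (allpairs_f _ ts ts').
  by exists g; split; [exists h|exists h'].
have ug := div (gn _ Gg); have us' := div (gn _ Gs).
have uk := div (hn _ Hk); have uh := div (hn _ Hh).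
have ut : t \is a GRing.unit by move: ug; rewrite gE unitrMr.
have uk' := div (hn _ Hk'); have uh' := div (hn _ Hh').
have ut' : t' \is a GRing.unit by move: us'; rewrite gE' unitrMr.
have uu : u \is a GRing.unit by rewrite uE /= unitrMr.
exists u => //; exists (g * u^-1); split; last by rewrite mulrVK.
split.
  by rewrite gE uE /= invrM // mulrA mulrK //; apply: hM => //; exact: hV.
rewrite starM uE' /=.
have -> : star g = (h' * t')^-1 by rewrite -gE' (starV div inv) invrK.
by rewrite invrM // mulrA mulrK //; apply: hM => //; exact: hV.
Qed.

End StarCore.

Theorem theorem1p4 (D : unitRingType) (star : D -> D) (N G : D -> Prop) :
  division_ring D ->
  (2%:R : D) != 0 ->
  k_involution star ->
  normal_in_units N ->
  is_subgroup G -> subset_of G N ->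
  torsion_free G -> nilpotent_by_finite G -> ~ abelian_by_finite G ->
  star_stable star G -> star_stable star N ->
  exists u v, [/\ N u, N v, star u = u, star v = v & free_pair u v].
Proof.
move=> div D2 inv norN sG GN tf [H0 [sH0 HG fi [n Hn]]] nab starG starN.
have [_ _ _ starK] := inv.
pose H := star_core star H0.
have sH : is_subgroup H by exact: star_core_subgroup.
have fH : finite_index H G by exact: star_core_finite_index.
have HH0 : subset_of H H0 by move=> a [].
have HsG : subset_of H G by move=> a /HH0 /HG.
have starH a : H a -> H (star a) by move=> [Ha Hsa]; split; rewrite ?starK.
have tfH : torsion_free H by move=> a k /HsG; exact: tf.
have nH : nilpotent H by exists n => a La; apply: Hn; exact: lcs_mono HH0 _ La.
have nabH : ~ abelian H by move=> aH; apply: nab; exists H.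
have [x [y [q [b_x [b_y [[Hx Hy q0] qN [yx qx qy] sx sy]]]]]] :=
  heisenberg_pair div inv sH starH tfH nH nabH.
have [_ Hn0 _ _] := sH.
exact: (quantum_pair_free div D2 inv norN starN (GN _ (HsG _ Hx)) (GN _ (HsG _ Hy))
  (Hn0 _ Hx) (Hn0 _ Hy) q0 qN yx qx qy sx sy).
Qed.
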